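(* Let $\mu,\lambda\in A_2$ and let $d\tau$ be a nonnegative measure on $\mathbb{D}$. Then the following are equivalent: (i) there is $B<\infty$ such that for all $f\in L^2(\mathbb{T},\mu\,dm)$, $\int_{\mathbb{D}}|f|^2\lambda\,d\tau\le B\int_{\mathbb{T}}|f|^2\mu\,dm$; (ii) there is $C<\infty$ such that $\sup_{z\in\mathbb{D}}\frac{1}{\mu(z)}\|P_z\|_{L^1(\lambda\,d\tau)}<C$; (iii) there is a constant $D$ such that $\frac{1}{\mu(I_S)}(\lambda\,d\tau)(S)<D$ for all sectors $S=\{re^{i\theta}:1-h\le r<1,\ |\theta-\theta_0|\le h\}$, where $I_S$ is the arc of length $h$ centered at $e^{i\theta_0}$ and $\mu(I_S)=\int_{I_S}\mu\,dm$.
   Context: $\mathbb{T}$ is the unit circle, $\mathbb{D}$ the unit disc, $dm$ normalized arc length measure. A weight $w\ge0$ is in $A_2$ if $\sup_{I}\big(\frac{1}{|I|}\int_I w\,dm\big)\big(\frac{1}{|I|}\int_I w^{-1}dm\big)<\infty$ over subarcs $I\subset\mathbb{T}$. $P_z(\zeta)=\frac{1-|z|^2}{|1-\bar z\zeta|^2}$ is the Poisson kernel; functions on $\mathbb{T}$ (such as $f$, $\mu$, $\lambda$) are evaluated at points $z\in\mathbb{D}$ via their Poisson (harmonic) extension $u(z)=\int_{\mathbb{T}}uP_z\,dm$; $\lambda\,d\tau$ denotes the measure on $\mathbb{D}$ with density $\lambda(z)$ (Poisson extension) with respect to $\tau$. A measure satisfying these conditions is called $\lambda$-$\mu$ Carleson.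 *)

(* Defs.v *)
From mathcomp Require Import all_boot all_order all_algebra.
From mathcomp Require Import all_classical all_reals all_analysis.
Set Implicit Arguments. Unset Strict Implicit. Unset Printing Implicit Defensive.
Import Order.TTheory GRing.Theory Num.Theory.
Local Open Scope classical_set_scope.
Local Open Scope ring_scope.

(* Conventions.
   * The unit circle T is parametrised by t |-> (cos t, sin t); functions on T
     are 2*pi-periodic functions R -> R.  Normalized arc measure:
     dm = dt / (2 pi) on [-pi, pi].
   * The unit disc D is the set of points (x, y) in R * R with x^2 + y^2 < 1;
     a point z = (x,y) stands for the complex number x + i y.
   * Measures on D are measures on R * R (product Borel sigma-algebra),
     integrated over D. *)

Section Defs.
Variable R : realType.
Local Notation leb := (@lebesgue_measure R).

Definition periodic2pi (u : R -> R) : Prop := forall t, u (t + 2 * pi) = u t.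

Definition disc : set (R * R) := [set p | p.1 ^+ 2 + p.2 ^+ 2 < 1].

(* Poisson kernel P_z(zeta) = (1 - |z|^2) / |1 - conj(z) zeta|^2,
   with z = (x,y), zeta = (u,v); conj(z) zeta = (xu + yv) + i (xv - yu). *)
Definition poisson (z zeta : R * R) : R :=
  (1 - (z.1 ^+ 2 + z.2 ^+ 2)) /
  ((1 - (z.1 * zeta.1 + z.2 * zeta.2)) ^+ 2 + (z.1 * zeta.2 - z.2 * zeta.1) ^+ 2).

Definition circ (t : R) : R * R := (cos t, sin t).

Definition pext (u : R -> R) (z : R * R) : R :=
  (2 * pi)^-1 * Rintegral leb `[- pi, pi] (fun t => u t * poisson z (circ t)).

Definition einv (w : R -> R) (t : R) : \bar R :=
  if w t == 0 then +oo%E else ((w t)^-1)%:E.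

(* Muckenhoupt A_2 condition for a weight on T (as a periodic function on R).
   Subarcs I of T are {circ t | a <= t <= b} with 0 < b - a <= 2 pi;
   |I| = (b - a)/(2 pi), so the averages (1/|I|) int_I w dm equal
   (1/(b-a)) int_a^b w dt. *)
Definition A2 (w : R -> R) : Prop :=
  [/\ measurable_fun setT w, (forall t, 0 <= w t), periodic2pi w &
   exists K : R, forall a b : R, a < b -> b <= a + 2 * pi ->
     [/\ (\int[leb]_(t in `[a, b]) (w t)%:E < +oo)%E,
         (\int[leb]_(t in `[a, b]) einv w t < +oo)%E &
         ((b - a)^-1 * fine (\int[leb]_(t in `[a, b]) (w t)%:E)) *
         ((b - a)^-1 * fine (\int[leb]_(t in `[a, b]) einv w t)) <= K]].

(* int_T |f|^2 mu dm for f = fr + i fi. *)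
Definition wL2norm2 (mu fr fi : R -> R) : \bar R :=
  (((2 * pi)^-1)%R%:E *
   \int[leb]_(t in `[(- pi)%R, pi%R]) ((fr t ^+ 2 + fi t ^+ 2) * mu t)%R%:E)%E.

Definition sector (h theta0 : R) : set (R * R) :=
  [set p | exists r theta : R, [/\ 1 - h <= r, r < 1,
     `|theta - theta0| <= h & p = (r * cos theta, r * sin theta)]].

Definition arcmass (mu : R -> R) (h theta0 : R) : \bar R :=
  (((2 * pi)^-1)%R%:E *
   \int[leb]_(t in `[(theta0 - h / 2)%R, (theta0 + h / 2)%R]) (mu t)%:E)%E.

End Defs.

(* Main.v *)
Require Import Defs.
From HB Require Import structures.
From mathcomp Require Import all_boot all_order all_algebra.
From mathcomp Require Import all_classical all_reals all_analysis.
From mathcomp Require Import measurable_realfun zify ring lra.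
Set Implicit Arguments. Unset Strict Implicit. Unset Printing Implicit Defensive.
Import Order.TTheory GRing.Theory Num.Theory.
Import numFieldNormedType.Exports.
Local Open Scope classical_set_scope.
Local Open Scope ring_scope.

(** Everything passes through the sector condition (iii). Write [W] for the mass of
    [mu] and [S] for the mass of [1 / mu] on arcs, so that [|I|^2 <= W I * S I <= K |I|^2].

    (ii) <-> (iii): the Poisson kernel at [z] is dominated by a dyadic sum of indicators
    of sectors (or arcs), [P_z <= C (1 - |z|) (1 + sum_(m <= n) 4^m 1_(S_m))]. Reverse
    doubling of [S] makes [sum_(m <= n) 4^m W I_m] comparable to its last term, so the
    Poisson extension of [mu] at [z] is comparable to the average of [mu] over the arc
    of length [1 - |z|] below [z].

    (i) -> (iii): test on the indicator of a dilated arc and use doubling.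

    (iii) -> (i): the same kernel bound and Cauchy-Schwarz reduce the embedding to a
    dyadic sum [sum_L al_L (X_L / |L|)^2], where [X_L] is the integral of [|f|] over [L]
    and [al] is a Carleson sequence for [mu]. The dyadic Carleson embedding, proved by
    a Bellman function, is applied twice: first with the weight [mu] to [1 / mu], which
    shows that [al_L (|L| / W L)^2] is a Carleson sequence for [1 / mu], then with the
    weight [1 / mu] to [|f| mu]. *)

(** The obstacle in the embedding is the number of scales. The kernel at [z] is a sum over all
    scales from 1 down to [1 - |z|], and squaring it naively costs a factor equal to their number.
    So [(1 - |z|) * 4^m] is split as [2^m * (1 - |z|)] times [2^m]: the first numbers are geometric
    in [m] with sum at most 2, and Cauchy-Schwarz against them leaves a sum of squared averages
    without loss. Integrated over suitable points of the disc, the same numbers define [al]; since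
    they sum to at most 2 over a subtree, [al] inherits its Carleson property from (iii).

    Centred arcs are not dyadic, but the arc of radius [2^-m] about the angle of [z] lies in three
    consecutive dyadic arcs. Each of the three offsets gets its own sequence [al]. Only finitely
    many generations matter at a given [z], so a bound uniform in the depth suffices. *)

Section DyadicPowers.
Variable R : realType.

Lemma sqr_expV2 n : 4 ^+ n * (2^-1 ^+ n) ^+ 2 = 1 :> R.
Proof.
by rewrite -exprM mulnC exprM -exprMn (_ : 4 * 2^-1 ^+ 2 = 1) ?expr1n//; field.
Qed.

Lemma expV2_gt0 m : 0 < 2^-1 ^+ m :> R.
Proof. by rewrite exprn_gt0// invr_gt0. Qed.

Lemma expV2_le1 m : 2^-1 ^+ m <= 1 :> R.
Proof. by rewrite exprn_ile1// invf_le1//; lra. Qed.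

Lemma expV2M m : 2 ^+ m * 2^-1 ^+ m = 1 :> R.
Proof. by rewrite -exprMn divff ?expr1n. Qed.

Lemma expV2_le m n : (m <= n)%N -> 2^-1 ^+ n <= 2^-1 ^+ m :> R.
Proof. by move=> mn; rewrite ler_wiXn2l// ?invr_ge0// invf_le1//; lra. Qed.

End DyadicPowers.

(** * Masses of periodic densities on intervals *)

Section IntervalMass.
Variable R : realType.
Local Notation leb := (@lebesgue_measure R).
Implicit Types (u : R -> \bar R) (a b c : R).

Lemma lebesgue_measure_shift c (A : set R) : measurable A ->
  pushforward leb ((fun t => t + c) : _ -> measurableTypeR R) A = leb A.
Proof.
have mc : measurable_fun setT ((fun t => t + c) : measurableTypeR R -> measurableTypeR R).
  exact: measurable_funD.
move=> mA; apply/esym.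
pose phim := isMeasurableFun.Build _ _ _ _ _ mc.
pose phi : {mfun (measurableTypeR R) >-> (measurableTypeR R)} :=
  HB.pack ((fun t => t + c) : measurableTypeR R -> measurableTypeR R) phim.
apply: (@lebesgue_measure_unique _ (pushforward leb phi)) => //= _ [[a b]] _ <-.
rewrite /pushforward.
have -> : phi @^-1` `]a, b] = `]a - c, b - c]%classic.
  by apply/seteqP; split=> t /=; rewrite !in_itv/= ltrBlDr lerBrDr.
by rewrite !lebesgue_measure_itv/= !lte_fin ltrD2r -!EFinD opprD opprK addrACA addNr addr0.
Qed.

Definition imass u a b : \bar R := (\int[leb]_(t in `[a, b]) u t)%E.

Lemma imass_ge0 u a b : (forall t, (0 <= u t)%E) -> (0 <= imass u a b)%E.
Proof. by move=> u0; apply: integral_ge0. Qed.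

Lemma imassD u a b c : measurable_fun setT u -> (forall t, (0 <= u t)%E) ->
  a <= b -> b <= c -> imass u a c = (imass u a b + imass u b c)%E.
Proof.
move=> mu u0 ab bc; rewrite /imass.
have -> : `[a, c]%classic = `[a, b]%classic `|` `]b, c]%classic.
  by rewrite -itv_bndbnd_setU// bnd_simp.
rewrite ge0_integral_setU//.
- by rewrite (integral_itv_obnd_cbnd (b := BRight c))//; exact: measurable_funTS.
- exact: measurable_funTS.
- rewrite disj_set2E; apply/eqP/seteqP; split => // t [] /=; rewrite !in_itv/=.
  by move=> /andP[_ tb] /andP[/lt_geF]; rewrite tb.
Qed.

Lemma imass_shift u a b c : measurable_fun setT u -> (forall t, (0 <= u t)%E) ->
  imass u (a + c) (b + c) = imass (fun t => u (t + c)) a b.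
Proof.
move=> mu u0; rewrite /imass.
have mc : measurable_fun setT ((fun t => t + c) : measurableTypeR R -> measurableTypeR R).
  exact: measurable_funD.
have -> : `[a, b]%classic =
    ((fun t => t + c) : measurableTypeR R -> measurableTypeR R) @^-1` `[a + c, b + c].
  by apply/seteqP; split=> t /=; rewrite !in_itv/= !lerD2r.
rewrite -(ge0_integral_pushforward mc)//=; last exact: measurable_funTS.
by apply: eq_measure_integral => //= A mA _; exact/esym/lebesgue_measure_shift.
Qed.

(** All that is kept of a weight. In this form [mu] and the extended-valued [1 / mu] are on the same
    footing. *)
Definition interval_function (V : R -> R -> R) : Prop :=
  [/\ forall a b, a <= b -> 0 <= V a b,
      forall a b c, a <= b -> b <= c -> V a c = V a b + V b c &
      forall a b, a <= b -> V (a + 2 * pi) (b + 2 * pi) = V a b].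

Definition periodic_density u : Prop :=
  [/\ measurable_fun setT u, (forall t, (0 <= u t)%E),
      (forall t, u (t + 2 * pi) = u t) & (imass u (- pi) pi < +oo)%E].

Definition rmass u a b : R := fine (imass u a b).

(** Induction on windows that gain one period at each end: an added period is a translate of an
    interval inside the previous window. *)
Lemma imass_fin u a b : periodic_density u -> imass u a b \is a fin_num.
Proof.
move=> [mu u0 up uf].
have shf x y : imass u (x + 2 * pi) (y + 2 * pi) = imass u x y.
  by rewrite imass_shift//; congr imass; apply/funext => t.
have pi0 := @pi_gt0 R.
have mono x y x' y' : x' <= x -> y <= y' -> (imass u x y <= imass u x' y')%E.
  move=> xx yy; apply: ge0_subset_integral => //.
    exact: measurable_funTS.
  by apply: subset_itv; rewrite bnd_simp.
have fin n : (imass u (- pi - 2 * pi * n%:R) (pi + 2 * pi * n%:R) < +oo)%E.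
  elim: n => [|n IH]; first by rewrite mulr0 subr0 addr0.
  have n0 : (0 : R) <= n%:R by [].
  rewrite -[n.+1%:R]natr1; set p : R := n%:R in n0 IH *.
  have p0 : 0 <= pi * p by rewrite mulr_ge0// ltW.
  rewrite (@imassD u _ (- pi - 2 * pi * p))//; [|nra|nra].
  rewrite (@imassD u (- pi - 2 * pi * p) (pi + 2 * pi * p))//; [|nra|nra].
  have l : (imass u (- pi - 2 * pi * (p + 1)) (- pi - 2 * pi * p) < +oo)%E.
    rewrite -shf; apply: le_lt_trans IH; apply: mono; nra.
  have r : (imass u (pi + 2 * pi * p) (pi + 2 * pi * (p + 1)) < +oo)%E.
    have -> : pi + 2 * pi * p = (- pi + 2 * pi * p) + 2 * pi by ring.
    have -> : pi + 2 * pi * (p + 1) = (pi + 2 * pi * p) + 2 * pi by ring.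
    rewrite shf; apply: le_lt_trans IH; apply: mono; nra.
  by rewrite lte_add_pinfty// lte_add_pinfty.
rewrite ge0_fin_numE ?imass_ge0//.
have [n hn] : exists n : nat, `|a| + `|b| <= 2 * pi * n%:R.
  exists (Num.truncn ((`|a| + `|b|) / (2 * pi))).+1.
  by rewrite -ler_pdivrMl; [rewrite mulrC; exact/ltW/truncnS_gt|nra].
apply: le_lt_trans (fin n); apply: mono.
  have := ler_norm (- a); rewrite normrN; have := normr_ge0 b; nra.
by have := ler_norm b; have := normr_ge0 a; nra.
Qed.

Lemma rmassK u a b : periodic_density u -> imass u a b = (rmass u a b)%:E.
Proof. by move=> hu; rewrite fineK// imass_fin. Qed.

Lemma rmass_interval_function u : periodic_density u -> interval_function (rmass u).
Proof.
move=> hu; have [mu u0 up uf] := hu; split.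
- by move=> a b _; rewrite fine_ge0// imass_ge0.
- move=> a b c ab bc; rewrite /rmass (imassD mu u0 ab bc) fineD//; exact: imass_fin.
- move=> a b ab; rewrite /rmass imass_shift//; congr (fine (imass _ _ _)).
  by apply/funext => t.
Qed.

(* AM-GM pointwise, then optimisation over the parameter [s]. *)
Lemma sqr_rmass_le u v w a b : periodic_density u -> periodic_density v ->
  periodic_density w ->
  (forall s t, 0 < s -> (u t <= (s / 2)%:E * v t + ((2 * s)^-1)%:E * w t)%E) ->
  rmass u a b ^+ 2 <= rmass v a b * rmass w a b.
Proof.
move=> hu hv hw H.
have [mu u0 _ _] := hu; have [mv v0 _ _] := hv; have [mw w0 _ _] := hw.
set x := rmass u a b; set y := rmass v a b; set z := rmass w a b.
have x0 : 0 <= x by rewrite fine_ge0// imass_ge0.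
have y0 : 0 <= y by rewrite fine_ge0// imass_ge0.
have z0 : 0 <= z by rewrite fine_ge0// imass_ge0.
have K s : 0 < s -> x <= s / 2 * y + (2 * s)^-1 * z.
  move=> s0; have s20 : 0 <= s / 2 by lra.
  have s21 : 0 <= (2 * s)^-1 by rewrite invr_ge0; lra.
  rewrite -lee_fin EFinD !EFinM -!rmassK// /imass.
  rewrite -!ge0_integralZl_EFin//; [|exact: measurable_funTS..].
  have mZ (k : R) (f : R -> \bar R) : measurable_fun setT f ->
      measurable_fun `[a, b] (fun t => (k%:E * f t)%E).
    by move=> mf; apply: measurable_funeM; exact: measurable_funTS.
  rewrite -ge0_integralD//; [|by move=> *; rewrite mule_ge0|exact: mZ|by move=> *; rewrite mule_ge0|exact: mZ].
  apply: ge0_le_integral => //; first exact: measurable_funTS.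
    by apply: emeasurable_funD; exact: mZ.
  by move=> t _; exact: H.
have [x00|xn0] := eqVneq x 0; first by rewrite x00 expr0n/= mulr_ge0.
have xp : 0 < x by rewrite lt_def xn0.
have [y00|yn0] := eqVneq y 0.
  (* With [y = 0] a large [s] is free; this one makes the right side less than [x]. *)
  have := K ((z + 1) / x); rewrite y00 mulr0 add0r => /(_ _)/wrap[]; first by rewrite divr_gt0//; lra.
  rewrite (_ : (2 * ((z + 1) / x))^-1 * z = x * (z / (2 * (z + 1)))); last first.
    by field; rewrite xn0 /=; apply/andP; split => //; lra.
  have zz : z / (2 * (z + 1)) < 1 by rewrite ltr_pdivrMr; lra.
  by have := mulr_gt0 xp (_ : 0 < 1 - z / (2 * (z + 1))); rewrite subr_gt0 => /(_ zz); nra.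
have yp : 0 < y by rewrite lt_def yn0.
(* Instead of the minimiser [sqrt (z / y)]: this [s] needs no root and gives
   [x <= (x + y * z / x) / 2], which is equivalent to the claim. *)
have := K (x / y); rewrite divr_gt0// => /(_ isT).
rewrite (_ : x / y / 2 * y + (2 * (x / y))^-1 * z = (x + y * z / x) / 2); last first.
  by field; rewrite xn0 yn0.
move=> h; have : x <= y * z / x by lra.
by rewrite ler_pdivlMr// expr2.
Qed.

End IntervalMass.

(** * Doubling and reverse doubling *)

Section IntervalFunctions.
Variable R : realType.
Implicit Types (V W S : R -> R -> R) (a b c : R).

Lemma ifun_mono V a b a' b' : interval_function V -> a' <= a -> a <= b -> b <= b' ->
  V a b <= V a' b'.
Proof.
move=> [V0 VD _] aa ab bb.
rewrite (VD a' a b')//; last lra.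
rewrite (VD a b b')//.
by have := V0 _ _ aa; have := V0 _ _ bb; lra.
Qed.

Lemma ifun_shiftn V (n : nat) a b : interval_function V -> a <= b ->
  V (a + 2 * pi * n%:R) (b + 2 * pi * n%:R) = V a b.
Proof.
move=> [V0 VD Vp] ab; elim: n => [|n IH]; first by rewrite mulr0 !addr0.
rewrite -[n.+1%:R]natr1 mulrDr mulr1 !addrA Vp// lerD2r//.
Qed.

Lemma ifun_period V a : interval_function V -> V a (a + 2 * pi) = V (- pi) pi.
Proof.
move=> hV; have [V0 VD Vp] := hV; have pi0 := @pi_gt0 R.
have key (x c : R) : x <= c -> c <= x + 2 * pi -> V x (x + 2 * pi) = V c (c + 2 * pi).
  move=> xc cx; rewrite (VD x c)// (VD c (x + 2 * pi) (c + 2 * pi)) //; last lra.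
  by rewrite Vp// addrC.
have pos (x : R) : - pi <= x -> V x (x + 2 * pi) = V (- pi) pi.
  move=> hx; pose n := Num.truncn ((x + pi) / (2 * pi)).
  have q0 : 0 <= (x + pi) / (2 * pi) by rewrite divr_ge0//; lra.
  have /andP[n1 n2] := truncn_itv q0; rewrite -/n in n1 n2.
  rewrite ler_pdivlMr in n1; last lra.
  rewrite ltr_pdivrMr in n2; last lra.
  have n2' : x + pi < (n%:R + 1) * (2 * pi) by rewrite natr1.
  rewrite -(key (- pi + 2 * pi * n%:R) x); [|lra|lra].
  have -> : - pi + 2 * pi * n%:R + 2 * pi = pi + 2 * pi * n%:R :> R by ring.
  by rewrite ifun_shiftn//; lra.
pose n := Num.truncn (`|a| / (2 * pi)).
have hn : `|a| < 2 * pi * n.+1%:R.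
  by rewrite -ltr_pdivrMl; [rewrite mulrC; exact: truncnS_gt|lra].
rewrite -(ifun_shiftn n.+1 hV); last lra.
have -> : a + 2 * pi + 2 * pi * n.+1%:R = a + 2 * pi * n.+1%:R + 2 * pi by ring.
by rewrite pos//; have := ler_norm (- a); rewrite normrN; lra.
Qed.

Lemma ifun_periodn V a n : interval_function V ->
  V a (a + 2 * pi * n%:R) = n%:R * V (- pi) pi.
Proof.
move=> hV; have [V0 VD Vp] := hV; have pi0 := @pi_gt0 R; elim: n => [|n IH].
  rewrite mulr0 addr0 mul0r; have := VD a a a (lexx _) (lexx _); lra.
have n0 : (0 : R) <= n%:R by [].
rewrite (VD a (a + 2 * pi * n%:R)).
- have -> : a + 2 * pi * n.+1%:R = a + 2 * pi * n%:R + 2 * pi by ring.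
  by rewrite IH ifun_period//; ring.
- by rewrite lerDl mulr_ge0//; lra.
- by rewrite lerD2l ler_wpM2l ?ler_nat//; lra.
Qed.

(** The condition is symmetric, so doubling holds for both weights. Length 32 leaves room for the
    dilated arcs used below, of length at most 24. *)
Definition A2_pair K W S : Prop :=
  [/\ interval_function W, interval_function S,
      forall a b, a < b -> b <= a + 32 -> W a b * S a b <= K * (b - a) ^+ 2 &
      forall a b, a < b -> (b - a) ^+ 2 <= W a b * S a b].

Lemma A2_pair_sym K W S : A2_pair K W S -> A2_pair K S W.
Proof. by move=> [? ? H1 H2]; split => // *; rewrite mulrC; [exact: H1|exact: H2]. Qed.

(** An interval of length at most 32 fits in eight periods, so each of its two masses is at most 8
    times that of a period, whence [64 = 8 * 8]. *)
Lemma A2_pair_extend K W S : interval_function W -> interval_function S ->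
  (forall a b, a < b -> b <= a + 2 * pi -> W a b * S a b <= K * (b - a) ^+ 2) ->
  (forall a b, a < b -> (b - a) ^+ 2 <= W a b * S a b) ->
  A2_pair (64 * K) W S.
Proof.
move=> hW hS H1 H2; have pi2 := @pi_ge2 R.
have K1 : 1 <= K.
  have h := H2 (- pi) pi ltac:(lra); have h' := H1 (- pi) pi ltac:(lra) ltac:(lra).
  by have := le_trans h h'; rewrite ler_pMl// exprn_gt0//; lra.
split => // a b ab ba.
have [bl|bl] := leP b (a + 2 * pi).
  by apply: le_trans (H1 _ _ ab bl) _; rewrite ler_wpM2r ?sqr_ge0//; lra.
have [W0 _ _] := hW; have [S0 _ _] := hS.
have WT : W a b <= 8 * W (- pi) pi.
  by rewrite -(ifun_periodn a 8 hW); apply: ifun_mono => //; lra.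
have ST : S a b <= 8 * S (- pi) pi.
  by rewrite -(ifun_periodn a 8 hS); apply: ifun_mono => //; lra.
have h : W a b * S a b <= (8 * W (- pi) pi) * (8 * S (- pi) pi).
  by apply: ler_pM => //; [apply: W0|apply: S0]; lra.
apply: le_trans h _.
have := H1 (- pi) pi ltac:(lra) ltac:(lra).
have l2 : (pi - - pi) ^+ 2 <= (b - a) ^+ 2 :> R by rewrite ler_sqr ?nnegrE; lra.
move=> h1.
have h2 : K * (pi - - pi) ^+ 2 <= K * (b - a) ^+ 2 by rewrite ler_wpM2l//; lra.
lra.
Qed.

Lemma A2_pair_ge1 K W S : A2_pair K W S -> 1 <= K.
Proof.
move=> [_ _ H1 H2]; have := le_trans (H2 0 1 ltr01) (H1 0 1 ltr01 ltac:(lra)).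
by rewrite subr0 expr1n mulr1.
Qed.

Lemma A2_pair_gt0 K W S a b : A2_pair K W S -> a < b -> 0 < W a b.
Proof.
move=> [[W0 _ _] [S0 _ _] _ H2] ab; rewrite lt_def W0 ?(ltW ab)// andbT.
apply/eqP => W00; have := H2 _ _ ab; rewrite W00 mul0r.
by apply/negP; rewrite -ltNge exprn_gt0// subr_gt0.
Qed.

(** For [I] inside [I'], [|I|^2 <= W I * S I <= W I * S I'] and [W I' * S I' <= K * |I'|^2];
    multiply the first by [W I']. *)
Lemma A2_doubling K W S a b a' b' : A2_pair K W S ->
  a' <= a -> a < b -> b <= b' -> b' <= a' + 32 ->
  W a' b' * (b - a) ^+ 2 <= K * (b' - a') ^+ 2 * W a b.
Proof.
move=> h aa ab bb b32; have [hW hS H1 H2] := h.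
have [W0 _ _] := hW.
have w0 : 0 < W a b by exact: A2_pair_gt0 h ab.
have h1 := H1 a' b' ltac:(lra) b32.
have h2 := H2 _ _ ab.
have h3 : S a b <= S a' b' by apply: ifun_mono => //; lra.
have W0' : 0 <= W a' b' by apply: W0; lra.
have h4 : W a' b' * (b - a) ^+ 2 <= W a' b' * (W a b * S a b) by rewrite ler_wpM2l.
have h5 : W a b * S a b <= W a b * S a' b' by rewrite ler_wpM2l// ltW.
have h6 : W a' b' * (W a b * S a b) <= W a' b' * (W a b * S a' b') by rewrite ler_wpM2l.
have h7 : (W a' b' * S a' b') * W a b <= K * (b' - a') ^+ 2 * W a b by rewrite ler_wpM2r// ltW.
lra.
Qed.

(* Reverse doubling of the dual weight [S] makes [1 / S] grow geometrically; plain
   doubling of [W] would lose a logarithm here. *)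
Lemma A2_tail K W S t (n : nat) : A2_pair K W S ->
  \sum_(m < n.+1) 4 ^+ m * W (t - 2^-1 ^+ m) (t + 2^-1 ^+ m) <=
  16 * K ^+ 2 * (4 ^+ n * W (t - 2^-1 ^+ n) (t + 2^-1 ^+ n)).
Proof.
move=> h; have K1 := A2_pair_ge1 h; have [hW hS H1 H2] := h.
pose s m := S (t - 2^-1 ^+ m) (t + 2^-1 ^+ m).
pose w m := W (t - 2^-1 ^+ m) (t + 2^-1 ^+ m).
have p0 := @expV2_gt0 R.
have p1 := @expV2_le1 R.
have s0 m : 0 < s m by apply: A2_pair_gt0 (A2_pair_sym h) _; have := p0 m; lra.
have w0 m : 0 < w m by apply: A2_pair_gt0 h _; have := p0 m; lra.
have q := @sqr_expV2 R.
have f m : 0 < 4 ^+ m :> R by rewrite exprn_gt0.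
have ws m : 4 ^+ m * w m <= 4 * K / s m.
  rewrite ler_pdivlMr//.
  have := H1 (t - 2^-1 ^+ m) (t + 2^-1 ^+ m) ltac:(have := p0 m; lra) ltac:(have := p1 m; lra).
  rewrite -/(w m) -/(s m) => /(ler_wpM2l (ltW (f m))).
  have -> : 4 ^+ m * (K * (t + 2^-1 ^+ m - (t - 2^-1 ^+ m)) ^+ 2) =
    4 * K * (4 ^+ m * (2^-1 ^+ m) ^+ 2) by ring.
  by rewrite q mulr1 mulrA.
have sw m : 4 / s m <= 4 ^+ m * w m.
  rewrite ler_pdivrMr//.
  have := H2 (t - 2^-1 ^+ m) (t + 2^-1 ^+ m) ltac:(have := p0 m; lra).
  rewrite -/(w m) -/(s m) => /(ler_wpM2l (ltW (f m))).
  have -> : 4 ^+ m * (t + 2^-1 ^+ m - (t - 2^-1 ^+ m)) ^+ 2 =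
    4 * (4 ^+ m * (2^-1 ^+ m) ^+ 2) by ring.
  by rewrite q mulr1 mulrA.
(* The end piece [E] has a quarter of the length of the arc of level [m], so doubling gives it at
   least [s m / (16 * K)]; the arc of level [m + 1] misses it. *)
have rd m : 16 * K * s m.+1 <= (16 * K - 1) * s m.
  have hp := p0 m; have hp1 := p1 m.
  have e : 2^-1 ^+ m.+1 = 2^-1 ^+ m / 2 :> R by rewrite exprSr.
  have d := A2_doubling (a := t - 2^-1 ^+ m) (b := t - 2^-1 ^+ m.+1)
    (a' := t - 2^-1 ^+ m) (b' := t + 2^-1 ^+ m) (A2_pair_sym h)
    ltac:(lra) ltac:(lra) ltac:(lra) ltac:(lra).
  have [S0 SD _] := hS.
  have a1 := SD (t - 2^-1 ^+ m) (t - 2^-1 ^+ m.+1) (t + 2^-1 ^+ m) ltac:(lra) ltac:(lra).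
  have a2 := SD (t - 2^-1 ^+ m.+1) (t + 2^-1 ^+ m.+1) (t + 2^-1 ^+ m) ltac:(lra) ltac:(lra).
  have a3 := S0 (t + 2^-1 ^+ m.+1) (t + 2^-1 ^+ m) ltac:(lra).
  rewrite -/(s m) in d a1; rewrite -/(s m.+1) in a2.
  set E := S (t - 2^-1 ^+ m) (t - 2^-1 ^+ m.+1) in d a1.
  have d' : s m <= 16 * K * E.
    move: d; rewrite e.
    have -> : t - 2^-1 ^+ m / 2 - (t - 2^-1 ^+ m) = 2^-1 ^+ m / 2 by field.
    have -> : t + 2^-1 ^+ m - (t - 2^-1 ^+ m) = 2 * 2^-1 ^+ m by ring.
    have -> : s m * (2^-1 ^+ m / 2) ^+ 2 = s m / 4 * (2^-1 ^+ m) ^+ 2 by field.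
    have -> : K * (2 * 2^-1 ^+ m) ^+ 2 * E = 4 * K * E * (2^-1 ^+ m) ^+ 2 by ring.
    by rewrite ler_pM2r ?exprn_gt0// => d; lra.
  have sE : s m.+1 <= s m - E by lra.
  have : 16 * K * s m.+1 <= 16 * K * (s m - E) by rewrite ler_wpM2l//; lra.
  by rewrite mulrBr; lra.
(* The gap between [16 * K / s n.+1] and [(16 * K - 1) / s n.+1] absorbs the new term. *)
have si : \sum_(m < n.+1) (s m)^-1 <= 16 * K / s n.
  elim: n => [|n IH].
    rewrite big_ord_recr big_ord0 /= add0r -[leLHS]mul1r ler_wpM2r ?invr_ge0 ?(ltW (s0 _))//; lra.
  rewrite big_ord_recr /=.
  have : 16 * K / s n <= (16 * K - 1) / s n.+1.
    by rewrite ler_pdivrMr// mulrAC ler_pdivlMr//; exact: rd.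
  by rewrite mulrBl mul1r; lra.
apply: (@le_trans _ _ (\sum_(m < n.+1) 4 * K * (s m)^-1)).
  by apply: ler_sum => m _; exact: ws.
rewrite -mulr_sumr.
have h1 : 4 * K * (\sum_(m < n.+1) (s m)^-1) <= 4 * K * (16 * K / s n) by rewrite ler_wpM2l//; lra.
apply: le_trans h1 _; rewrite -/(w n).
have -> : 4 * K * (16 * K / s n) = 16 * K ^+ 2 * (4 / s n) by ring.
by rewrite ler_wpM2l// mulr_ge0// sqr_ge0.
Qed.

End IntervalFunctions.

(** * Dyadic trees and the Carleson embedding *)

Section DyadicTree.
Variable R : realType.
Implicit Types (al W X Y : nat -> nat -> R).

(** [N] generations starting with the node [(m, j)] itself; the recursion peels off the root, as the
    Bellman induction does. *)
Fixpoint tsum al (N m j : nat) : R :=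
  if N is N'.+1 then
    al m j + (tsum al N' m.+1 j.*2 + tsum al N' m.+1 j.*2.+1)
  else 0.

Lemma tsumE al N m j : tsum al N m j =
  \sum_(d < N) \sum_(k < 2 ^ d) al (m + d)%N (2 ^ d * j + k)%N.
Proof.
elim: N m j => [|N IH] m j; first by rewrite big_ord0.
rewrite /= !IH big_ord_recl /= big_ord_recl big_ord0 addr0 !addn0 mul1n; congr (_ + _).
rewrite -big_split; apply: eq_bigr => d _ /=.
rewrite /bump /= add1n addSnnS expnS mul2n -[(2 ^ d).*2]addnn big_split_ord /=.
by congr (_ + _); apply: eq_bigr => k _; congr (al _ _); rewrite -!muln2; lia.
Qed.

Lemma tsum_ge0 al N m j : (forall m j, 0 <= al m j) -> 0 <= tsum al N m j.
Proof. by move=> h; elim: N m j => //= N IH m j; rewrite !addr_ge0. Qed.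

Lemma ler_tsum al be N m j : (forall m j, al m j <= be m j) ->
  tsum al N m j <= tsum be N m j.
Proof. by move=> h; elim: N m j => //= N IH m j; rewrite !lerD. Qed.

Lemma tsumZ (c : R) al N m j :
  tsum (fun m j => c * al m j) N m j = c * tsum al N m j.
Proof.
by elim: N m j => [|N IH] m j /=; rewrite ?mulr0// !IH !mulrDr.
Qed.

Definition tree_additive W : Prop :=
  forall m j, W m j = W m.+1 j.*2 + W m.+1 j.*2.+1.

(** Joint convexity of [x^2 / p], which is homogeneous of degree 1; the defect is an explicit
    square. *)
Lemma sqr_div_convex (x1 x2 p1 p2 : R) : 0 < p1 -> 0 < p2 ->
  (x1 + x2) ^+ 2 / (p1 + p2) <= x1 ^+ 2 / p1 + x2 ^+ 2 / p2.
Proof.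
move=> h1 h2; rewrite ler_pdivrMr ?addr_gt0//.
have -> : (x1 ^+ 2 / p1 + x2 ^+ 2 / p2) * (p1 + p2) =
  (x1 + x2) ^+ 2 + (x1 * p2 - x2 * p1) ^+ 2 / (p1 * p2).
  by field; rewrite !gt_eqF.
by rewrite lerDl divr_ge0 ?sqr_ge0// mulr_ge0// ltW.
Qed.

(* Induction with the Bellman function [Y - X^2 / (W + A)], which is concave and
   whose derivative in [A] dominates [X^2 / (4 W^2)] for [0 <= A <= W]. *)
Lemma carleson_embedding_bellman (C : R) W X Y al N m j : 0 < C ->
  tree_additive W -> tree_additive X -> tree_additive Y ->
  (forall m j, 0 < W m j) -> (forall m j, X m j ^+ 2 <= W m j * Y m j) ->
  (forall m j, 0 <= al m j) ->
  (forall N m j, tsum al N m j <= C * W m j) ->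
  tsum (fun m j => al m j * (X m j / W m j) ^+ 2) N m j <=
  4 * C * (Y m j - X m j ^+ 2 / (W m j + tsum al N m j / C)).
Proof.
move=> C0 hW hX hY W0 CS al0 car; elim: N m j => [|N IH] m j.
  rewrite /= mul0r addr0; have := CS m j; have w := W0 m j => cs.
  by rewrite mulr_ge0 ?subr_ge0 ?ler_pdivrMr ?mulr_ge0 ?(ltW C0)// mulrC.
move: (IH m.+1 j.*2) (IH m.+1 j.*2.+1) (car N.+1 m j) => /=.
set s1 := tsum al N m.+1 j.*2; set s2 := tsum al N m.+1 j.*2.+1.
set T1 := tsum _ N m.+1 j.*2; set T2 := tsum _ N m.+1 j.*2.+1.
have s10 : 0 <= s1 by exact: tsum_ge0.
have s20 : 0 <= s2 by exact: tsum_ge0.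
move: (al0 m j) (W0 m.+1 j.*2) (W0 m.+1 j.*2.+1); rewrite (hW m j) (hX m j) (hY m j).
set a := al m j; set w1 := W m.+1 _; set w2 := W m.+1 _.
set x1 := X m.+1 _; set x2 := X m.+1 _; set y1 := Y m.+1 _; set y2 := Y m.+1 _.
move=> a0 w10 w20 h1 h2 h3.
have p10 : 0 < w1 + s1 / C by rewrite ltr_wpDr// divr_ge0// ltW.
have p20 : 0 < w2 + s2 / C by rewrite ltr_wpDr// divr_ge0// ltW.
have cx := sqr_div_convex x1 x2 p10 p20.
have C4 : 0 <= 4 * C by lra.
set x := x1 + x2 in cx *; set w := w1 + w2.
have w0 : 0 < w by rewrite addr_gt0.
pose p := w + (s1 + s2) / C; pose q := w + (a + (s1 + s2)) / C.
have ep : w1 + s1 / C + (w2 + s2 / C) = p by rewrite /p /w; field; rewrite gt_eqF.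
rewrite ep in cx.
have p0 : 0 < p by rewrite -ep addr_gt0.
have q0 : 0 < q by rewrite /q ltr_wpDr// divr_ge0 ?addr_ge0// ltW.
(* The Carleson hypothesis at this node bounds the accumulated mass by [C * w]. *)
have hq : q <= 2 * w.
  by rewrite /q mulr_natl mulr2n lerD2l ler_pdivrMr// mulrC.
have hp : p <= q by rewrite /p /q lerD2l ler_wpM2r ?invr_ge0 ?(ltW C0)// lerDr.
(* Since [q = p + a / C], the right side is [4 * a * x^2 / (p * q)], and [p * q <= 4 * w^2]: hence
   the factor 4 of the embedding. *)
have key : a * (x / w) ^+ 2 <= 4 * C * (x ^+ 2 / p - x ^+ 2 / q).
  have -> : 4 * C * (x ^+ 2 / p - x ^+ 2 / q) = a * x ^+ 2 * (4 / (p * q)).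
    have e : q = p + a / C by rewrite /p /q; field; rewrite gt_eqF.
    have pca : 0 < p * C + a by rewrite ltr_wpDr// mulr_gt0.
    by rewrite e; field; rewrite !gt_eqF.
  have ax : 0 <= a * x ^+ 2 by apply: mulr_ge0 => //; exact: sqr_ge0.
  rewrite expr_div_n mulrA; apply: (ler_wpM2l ax).
  rewrite -[leLHS]mul1r ler_pdivrMr ?exprn_gt0// mulrAC ler_pdivlMr ?mulr_gt0//.
  have : p * q <= (2 * w) * (2 * w) by rewrite ler_pM ?(ltW p0) ?(ltW q0)//; lra.
  by rewrite mul1r expr2; lra.
have m1 := ler_wpM2l C4 cx.
by rewrite -/w -/p -/q -/x; lra.
Qed.

Lemma carleson_embedding (C : R) W X Y al N m j : 0 < C ->
  tree_additive W -> tree_additive X -> tree_additive Y ->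
  (forall m j, 0 < W m j) -> (forall m j, X m j ^+ 2 <= W m j * Y m j) ->
  (forall m j, 0 <= al m j) ->
  (forall N m j, tsum al N m j <= C * W m j) ->
  tsum (fun m j => al m j * (X m j / W m j) ^+ 2) N m j <= 4 * C * Y m j.
Proof.
move=> C0 hW hX hY W0 CS al0 car.
apply: le_trans (carleson_embedding_bellman N m j C0 hW hX hY W0 CS al0 car) _.
rewrite ler_wpM2l//; first lra.
rewrite gerBl divr_ge0 ?sqr_ge0// addr_ge0 ?(ltW (W0 _ _))// divr_ge0 ?(ltW C0)//.
exact: tsum_ge0.
Qed.

(* The embedding for [U] turns the [U]-Carleson sequence [al] into the [V]-Carleson
   sequence [al (L / U)^2]; the embedding for [V] then concludes. *)
Lemma two_weight_embedding (C K : R) U V L X Y al N m j : 0 < C -> 0 < K ->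
  tree_additive U -> tree_additive V -> tree_additive L ->
  tree_additive X -> tree_additive Y ->
  (forall m j, 0 < U m j) -> (forall m j, 0 < V m j) -> (forall m j, 0 < L m j) ->
  (forall m j, L m j ^+ 2 <= U m j * V m j) ->
  (forall m j, U m j * V m j <= K * L m j ^+ 2) ->
  (forall m j, 0 <= X m j) -> (forall m j, X m j ^+ 2 <= V m j * Y m j) ->
  (forall m j, 0 <= al m j) ->
  (forall N m j, tsum al N m j <= C * U m j) ->
  tsum (fun m j => al m j * (X m j / L m j) ^+ 2) N m j <= 16 * C * K ^+ 2 * Y m j.
Proof.
move=> C0 K0 hU hV hL hX hY U0 V0 L0 LUV UVK X0 XVY al0 car.
have c1 N' m' j' : tsum (fun m j => al m j * (L m j / U m j) ^+ 2) N' m' j' <= (4 * C) * V m' j'.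
  exact: carleson_embedding.
have C4 : 0 < 4 * C by lra.
have be0 m' j' : 0 <= al m' j' * (L m' j' / U m' j') ^+ 2 by rewrite mulr_ge0// sqr_ge0.
have c2 := carleson_embedding N m j C4 hV hX hY V0 XVY be0 c1.
apply: le_trans (_ : K ^+ 2 * (4 * (4 * C) * Y m j) <= _); last by lra.
apply: le_trans (ler_wpM2l (sqr_ge0 K) c2); rewrite -tsumZ.
apply: ler_tsum => m' j'.
have u := U0 m' j'; have v := V0 m' j'; have l := L0 m' j'.
(* [X / L] is [(L / U) * (X / V)] times [U * V / L^2], and the last factor is at most [K]. *)
rewrite (_ : K ^+ 2 * _ = al m' j' *
  (K * (L m' j' / U m' j' * (X m' j' / V m' j'))) ^+ 2); last by ring.
rewrite ler_wpM2l//.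
rewrite ler_sqr ?nnegrE; last 2 first.
- by rewrite divr_ge0// ltW.
- by rewrite !mulr_ge0// ?invr_ge0 ltW.
have -> : K * (L m' j' / U m' j' * (X m' j' / V m' j')) =
  X m' j' * (K * L m' j' / (U m' j' * V m' j')).
  by field; rewrite !gt_eqF.
rewrite ler_wpM2l// ler_pdivlMr ?mulr_gt0// ler_pdivrMl//.
by have := UVK m' j'; rewrite expr2; lra.
Qed.

End DyadicTree.

(** * Trigonometric bounds and the size of the kernel *)

Section Trigonometry.
Variable R : realType.
Implicit Types (x r s c H t : R).

Lemma pi_lt4 : pi < 4 :> R.
Proof. by have := @pihalf_lt2 R; lra. Qed.

Lemma one_sub_cosE x : 1 - cos x = 2 * sin (x / 2) ^+ 2.
Proof.
have e : cos x = cos (x / 2) ^+ 2 - sin (x / 2) ^+ 2.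
  by rewrite {1}(_ : x = x / 2 + x / 2) ?cosD -?expr2//; field.
by have := cos2Dsin2 (x / 2); lra.
Qed.

Lemma sin_MVT x : 0 <= x -> exists2 y, 0 <= y <= x & sin x = cos y * x.
Proof.
move=> x0; have [t|y yI] := @MVT_segment R sin cos _ _ x0.
  exact/continuous_subspaceT/continuous_sin.
by rewrite sin0 !subr0 => e; exists y => //; move: yI; rewrite in_itv.
Qed.

Lemma normr_sin_le x : `|sin x| <= `|x|.
Proof.
wlog x0 : x / 0 <= x.
  move=> H; have [/H//|/ltW x0] := leP 0 x.
  by rewrite -normrN -sinN -[leRHS]normrN H// oppr_ge0.
have [y _ ->] := sin_MVT x0; rewrite normrM ler_piMl//.
by rewrite ler_norml cos_geN1 cos_le1.
Qed.

Lemma one_sub_cos_le x : 1 - cos x <= x ^+ 2 / 2.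
Proof.
rewrite one_sub_cosE -real_normK ?num_real// -[x ^+ 2]real_normK ?num_real//.
have := normr_sin_le (x / 2); rewrite normrM (ger0_norm (_ : 0 <= 2^-1)); last lra.
have := normr_ge0 (sin (x / 2)); have := normr_ge0 x; nra.
Qed.

Lemma cos_pi4 : cos (pi / 4) ^+ 2 = 2^-1 :> R.
Proof.
have := one_sub_cosE (pi / 2 : R); rewrite cos_pihalf.
by have := cos2Dsin2 (pi / 2 / 2 : R); rewrite (_ : pi / 2 / 2 = pi / 4 :> R); [lra|field].
Qed.

Lemma ler_cos x t : 0 <= x -> x <= t -> t <= pi -> cos t <= cos x.
Proof.
move=> x0 xt tp; rewrite leNgt ltr_cos -?leNgt// in_itv/=; apply/andP; split; lra.
Qed.

(** Up to [pi / 4] by the mean value theorem with [cos >= 1 / 2]; beyond, [sin x >= 1 / 2 >= x / 4]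
    because [pi / 2 < 2]. *)
Lemma sin_ge x : 0 <= x -> x <= pi / 2 -> x / 4 <= sin x.
Proof.
move=> x0 xp; have pi0 := @pi_gt0 R; have pi4 := pi_lt4; have [xq|xq] := leP x (pi / 4).
  have [y /andP[y0 yx] ->] := sin_MVT x0.
  have c1 : cos (pi / 4) <= cos y by apply: ler_cos => //; lra.
  have c0 : 0 < cos (pi / 4 : R) by apply: cos_gt0_pihalf; apply/andP; split; lra.
  have c2 : 2^-1 <= cos (pi / 4 : R) by rewrite leNgt; apply/negP => c2; have := cos_pi4; nra.
  have : 4^-1 * x <= cos y * x by rewrite ler_wpM2r//; lra.
  lra.
have s0 : 0 < sin (pi / 4 : R) by apply: sin_gt0_pihalf; apply/andP; split; lra.
have s1 : sin (pi / 4) <= sin x.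
  by rewrite leNgt ltr_sin -?leNgt ?(ltW xq)// in_itv/=; apply/andP; split; lra.
have s2 : 2^-1 <= sin (pi / 4 : R).
  rewrite leNgt; apply/negP => s2.
  by have := cos_pi4; have := cos2Dsin2 (pi / 4 : R); nra.
lra.
Qed.

Lemma one_sub_cos_ge x : `|x| <= pi -> x ^+ 2 / 32 <= 1 - cos x.
Proof.
move=> xp; rewrite one_sub_cosE.
wlog x0 : x xp / 0 <= x.
  move=> H; have [/H->//|/ltW x0] := leP 0 x.
  by have := H (- x); rewrite normrN sqrrN mulNr sinN sqrrN oppr_ge0; exact.
rewrite ger0_norm// in xp.
have := @sin_ge (x / 2) ltac:(lra) ltac:(lra); nra.
Qed.

(** The second point may be interior, as in (ii), where the kernel is integrated over the disc. The
    denominator is [|1 - r s e^(i (t - x))|^2]. *)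
Lemma poisson_polar r x s t :
  poisson (r * cos x, r * sin x) (s * cos t, s * sin t) =
  (1 - r ^+ 2) / ((1 - r * s) ^+ 2 + 2 * (r * s) * (1 - cos (t - x))).
Proof.
rewrite /poisson /= cosB.
have e1 := cos2Dsin2 x; have e2 := cos2Dsin2 t.
congr (_ / _).
  by rewrite !exprMn -mulrDr e1 mulr1.
set cx := cos x in e1 *; set sx := sin x in e1 *; set ct := cos t in e2 *; set st := sin t in e2 *.
have -> : (1 - (r * cx * (s * ct) + r * sx * (s * st))) ^+ 2 +
   (r * cx * (s * st) - r * sx * (s * ct)) ^+ 2 =
   1 - 2 * (r * s) * (ct * cx + st * sx) + (r * s) ^+ 2 * ((cx ^+ 2 + sx ^+ 2) * (ct ^+ 2 + st ^+ 2)).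
  by ring.
by rewrite e1 e2; ring.
Qed.

Lemma poisson_circ r x t : poisson (r * cos x, r * sin x) (circ t) =
  (1 - r ^+ 2) / ((1 - r) ^+ 2 + 2 * r * (1 - cos (t - x))).
Proof.
by have := poisson_polar r x 1 t; rewrite !mul1r !mulr1.
Qed.

(** A point outside a sector of height [H] is either too deep, and then [1 - r * s >= H], or off in
    angle. In the second case the cosine term suffices, unless [r * s <= 1 / 2], and then the square
    is at least [1 / 4]. *)
Lemma poisson_den_ge H r s c : 0 < H -> H <= 1 -> 0 <= r -> r < 1 -> 0 <= s -> s <= 1 ->
  c <= 1 -> s < 1 - H \/ c <= cos H ->
  H ^+ 2 / 32 <= (1 - r * s) ^+ 2 + 2 * (r * s) * (1 - c).
Proof.
move=> H0 H1 r0 r1 s0 s1 c1 h.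
have rs0 : 0 <= r * s by exact: mulr_ge0.
have rs1 : r * s <= s by rewrite ler_piMl// ltW.
have pc : 0 <= (r * s) * (1 - c) by rewrite mulr_ge0// subr_ge0.
have sq := sqr_ge0 (1 - r * s).
case: h => [sH|cH].
  have : H ^+ 2 <= (1 - r * s) ^+ 2 by rewrite ler_sqr ?nnegrE; lra.
  by have := sqr_ge0 H; lra.
have hc : H ^+ 2 / 32 <= 1 - cos H.
  by apply: one_sub_cos_ge; rewrite gtr0_norm//; have := @pi_ge2 R; lra.
have H2 : H ^+ 2 <= 1 by rewrite expr_le1// ltW.
have [rs|rs] := leP (r * s) 2^-1.
  have : 2^-1 ^+ 2 <= (1 - r * s) ^+ 2 by rewrite ler_sqr ?nnegrE; lra.
  by rewrite expr2; have := sqr_ge0 H; lra.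
have : 2^-1 * (1 - c) <= (r * s) * (1 - c) by rewrite ler_wpM2r; lra.
lra.
Qed.

(** [b m] will say that the point lies in the sector of level [m]. A failure just after a success at
    [m] bounds [k] by [4 * B * 4^m], paid by the term of that success; a failure at 0 is paid by the
    1, a success at [n] by the last term. *)
Lemma dyadic_kernel_bound (B k : R) (b : nat -> bool) (n : nat) : 0 <= B ->
  (forall m, ~~ b m -> k <= B * 4 ^+ m) -> k <= B * 4 ^+ n ->
  k <= 4 * B * (1 + \sum_(m < n.+1) 4 ^+ m * (b m)%:R).
Proof.
move=> B0 hb hn.
have S0 N : 0 <= \sum_(m < N) 4 ^+ m * (b m)%:R :> R.
  by apply: sumr_ge0 => m _; rewrite mulr_ge0// exprn_ge0.
have P N : b N \/ k <= 4 * B * (1 + \sum_(m < N.+1) 4 ^+ m * (b m)%:R).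
  elim: N => [|N IH].
    have [?|nb] := boolP (b 0%N); [by left|right].
    have := hb _ nb; rewrite expr0; have := mulr_ge0 B0 (S0 1%N); lra.
  have [?|nb] := boolP (b N.+1); [by left|right].
  rewrite big_ord_recr /= (negbTE nb) mulr0 addr0.
  case: IH => // bN; apply: le_trans (hb _ nb) _.
  rewrite big_ord_recr /= bN mulr1 exprS mulrCA [B * _]mulrC mulrA.
  have := mulr_ge0 B0 (S0 N); rewrite mulrC; have : 0 <= 4 ^+ N :> R by rewrite exprn_ge0.
  by move=> f0; nra.
have [bn|//] := P n.
rewrite big_ord_recr /= bn mulr1; apply: le_trans hn _.
have := mulr_ge0 B0 (S0 n); have f0 : 0 <= 4 ^+ n :> R by rewrite exprn_ge0.
have := mulr_ge0 B0 f0; nra.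
Qed.

Lemma dyadic_level x : 0 < x -> x <= 1 ->
  exists n : nat, x <= 2^-1 ^+ n /\ 2^-1 ^+ n <= 2 * x.
Proof.
move=> x0 x1.
have ex : exists n : nat, 2^-1 ^+ n <= 2 * x.
  have [n hn] : exists n : nat, x^-1 <= n%:R.
    by exists (Num.truncn x^-1).+1; exact/ltW/truncnS_gt.
  exists n; rewrite exprVn -[leLHS]mul1r ler_pdivrMr ?exprn_gt0//.
  have : n%:R <= 2 ^+ n :> R by rewrite -natrX ler_nat; exact/ltnW/ltn_expl.
  move=> h; have := le_trans hn h; rewrite -(ler_pM2l x0) divff ?gt_eqF//; nra.
case: (ex_minnP ex) => n hn mn; exists n; split => //.
case: n hn mn => [|n] hn mn; first by rewrite expr0.
rewrite leNgt; apply/negP => lt.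
have := mn n _; rewrite ltnn => h; suff : false by []; apply: h.
by move: lt; rewrite exprS; lra.
Qed.

End Trigonometry.

(** * Polar coordinates and sectors *)

Section Polar.
Variable R : realType.
Implicit Types (z : R * R) (r h x t : R).

Definition rad z : R := Num.sqrt (z.1 ^+ 2 + z.2 ^+ 2).

(* The clipping makes [acos] monotone on the whole line, hence measurable. *)
Definition clipped_acos x : R := acos (Num.max (-1) (Num.min x 1)).

Definition ang z : R :=
  if 0 <= z.2 then clipped_acos (z.1 / rad z) else - clipped_acos (z.1 / rad z).

Lemma rad_ge0 z : 0 <= rad z. Proof. exact: sqrtr_ge0. Qed.

Lemma sqr_rad z : rad z ^+ 2 = z.1 ^+ 2 + z.2 ^+ 2.
Proof. by rewrite sqr_sqrtr// addr_ge0 ?sqr_ge0. Qed.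

Lemma clip_itv x : -1 <= Num.max (-1) (Num.min x 1) <= 1.
Proof. by rewrite le_max lexx ge_max ge_min lexx orbT andbT/=; lra. Qed.

Lemma clipped_acos_itv x : 0 <= clipped_acos x <= pi.
Proof. by rewrite acos_ge0 ?acos_lepi ?clip_itv. Qed.

Lemma clipped_acosE x : -1 <= x <= 1 -> clipped_acos x = acos x.
Proof. by move=> /andP[h1 h2]; rewrite /clipped_acos min_l// max_r. Qed.

Lemma clipped_acos_nonincreasing : nonincreasing_fun clipped_acos.
Proof.
move=> x y xy; have hx := clip_itv x; have hy := clip_itv y.
have le : Num.max (-1) (Num.min x 1) <= Num.max (-1) (Num.min y 1).
  by rewrite ge_max !le_max lexx /= le_min !ge_min xy lexx !orbT.
rewrite leNgt; apply/negP => lt; move: le; apply/negP; rewrite -ltNge.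
have := lt; rewrite -ltr_cos ?in_itv/= ?clipped_acos_itv//.
by rewrite /clipped_acos !acosK ?in_itv.
Qed.

Lemma ang_itv z : - pi <= ang z <= pi.
Proof.
rewrite /ang; have /andP[h1 h2] := clipped_acos_itv (z.1 / rad z).
by case: ifP => _; apply/andP; split; lra.
Qed.

Lemma polarE z : z = (rad z * cos (ang z), rad z * sin (ang z)).
Proof.
case: z => x y; have r0 := rad_ge0 (x, y); have r2 := sqr_rad (x, y).
rewrite /= in r2; have [r00|rn0] := eqVneq (rad (x, y)) 0.
  rewrite r00 !mul0r; move: r2; rewrite r00 expr0n/= => r2.
  have := sqr_ge0 x; have := sqr_ge0 y => y0 x0.
  have /eqP : x ^+ 2 = 0 by lra.
  have /eqP : y ^+ 2 = 0 by lra.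
  by rewrite !sqrf_eq0 => /eqP-> /eqP->.
have rp : 0 < rad (x, y) by rewrite lt_def rn0.
rewrite /ang /=; set r := rad (x, y) in r0 r2 rn0 rp *.
have xr : -1 <= x / r <= 1.
  have := sqr_ge0 y => y0; rewrite -ler_norml normrM normfV (gtr0_norm rp).
  by rewrite ler_pdivrMr// mul1r -ler_sqr ?nnegrE// real_normK ?num_real//; lra.
rewrite clipped_acosE//.
have sE : sin (acos (x / r)) = `|y| / r.
  rewrite sin_acos//; have -> : 1 - (x / r) ^+ 2 = (`|y| / r) ^+ 2.
    rewrite !expr_div_n real_normK ?num_real// (_ : y ^+ 2 = r ^+ 2 - x ^+ 2); last by lra.
    by field.
  by rewrite sqrtr_sqr ger0_norm// divr_ge0.
case: ifPn => [y0|]; last (rewrite -ltNge => y0).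
  by rewrite acosK ?in_itv// sE ger0_norm// ![r * _]mulrC !divfK.
by rewrite cosN sinN acosK ?in_itv// sE ltr0_norm// mulNr opprK ![r * _]mulrC !divfK.
Qed.

Lemma rad_polar r t : 0 <= r -> rad (r * cos t, r * sin t) = r.
Proof.
by move=> r0; rewrite /rad /= !exprMn -mulrDr cos2Dsin2 mulr1 sqrtr_sqr ger0_norm.
Qed.

Lemma discE z : disc z <-> rad z < 1.
Proof.
rewrite /disc /= -sqr_rad; have := rad_ge0 z => r0.
by rewrite expr_lt1.
Qed.

(** Reduction modulo [2 pi] without integers: [acos (cos u)] with the sign of [sin u]. *)
Lemma exists_angle_le h u : 0 <= h -> h <= pi -> cos h <= cos u ->
  exists v, [/\ `|v| <= h, cos v = cos u & sin v = sin u].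
Proof.
move=> h0 hp hu; pose v := acos (cos u).
have cu : -1 <= cos u <= 1 by rewrite cos_geN1 cos_le1.
have v0 : 0 <= v by exact: acos_ge0.
have vp : v <= pi by exact: acos_lepi.
have cv : cos v = cos u by rewrite acosK// in_itv.
have sv : sin v = `|sin u|.
  by rewrite sin_acos// -(cos2Dsin2 u) addrAC subrr add0r sqrtr_sqr.
have vh : v <= h.
  rewrite leNgt; apply/negP; rewrite -ltr_cos ?in_itv/= ?v0 ?vp ?h0 ?hp//.
  by rewrite cv ltNge hu.
have [su|su] := leP 0 (sin u).
  by exists v; rewrite ger0_norm// sv ger0_norm.
by exists (- v); rewrite normrN ger0_norm// cosN sinN sv ltr0_norm// opprK.
Qed.

(** The cosine form makes measurability visible and needs no reduction of angles. The common factor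
    [rad z] lets the origin, which lies in the sectors of height 1, pass the angular test. *)
Lemma sectorP h t z : 0 < h -> h <= 1 ->
  sector h t z <->
  [/\ 1 - h <= rad z, rad z < 1 & rad z * cos h <= rad z * cos (ang z - t)].
Proof.
move=> h0 h1; have pi2 := @pi_ge2 R; split.
  move=> [r [x [r1 r2 xh ->]]].
  have r0 : 0 <= r by lra.
  have := polarE (r * cos x, r * sin x); rewrite rad_polar// => -[e1 e2].
  split => //; rewrite cosB mulrDr !mulrA -e1 -e2 -!mulrA -mulrDr -cosB ler_wpM2l//.
  have -> : cos (x - t) = cos `|x - t|.
    by case: (ger0P (x - t)) => _; rewrite ?cosN.
  by apply: ler_cos => //; lra.
move=> [r1 r2 hc]; have r0 := rad_ge0 z; rewrite (polarE z).
have [r00|rn0] := eqVneq (rad z) 0.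
  by exists 0, t; rewrite subrr normr0 !r00 !mul0r; split => //; lra.
have rp : 0 < rad z by rewrite lt_def rn0.
rewrite ler_pM2l// in hc.
have [v [vh cv sv]] := exists_angle_le (ltW h0) ltac:(lra) hc.
exists (rad z), (t + v); split => //; first by rewrite addrAC subrr add0r.
have e : ang z = t + (ang z - t) by rewrite addrC subrK.
by rewrite {1 2}e !(cosD t) !(sinD t) cv sv.
Qed.

Lemma notin_sector h t z : 0 < h -> h <= 1 -> rad z < 1 -> ~ sector h t z ->
  rad z < 1 - h \/ cos (ang z - t) <= cos h.
Proof.
move=> h0 h1 r1 ns; have [?|rh] := ltP (rad z) (1 - h); [by left|right].
rewrite leNgt; apply/negP => lt; apply: ns; apply/sectorP => //; split => //.
by rewrite ler_wpM2l ?rad_ge0// ltW.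
Qed.

Lemma sector_disc h t : 0 < h -> h <= 1 -> sector h t `<=` @disc R.
Proof. by move=> h0 h1 z /sectorP[]// _ r _; apply/discE. Qed.

End Polar.

(** * Measurability of polar coordinates, sectors and Poisson extensions *)

Section Measurability.
Variable R : realType.

Section General.
Context d (T : measurableType d).
Implicit Types (D : set T) (f g : T -> R).

Lemma measurable_fun_inv D f : (forall x, 0 <= f x) -> measurable_fun D f ->
  measurable_fun D (fun x => (f x)^-1).
Proof.
move=> f0 mf; rewrite (_ : (fun x => _) = (@powR R ^~ (-1)) \o f); last first.
  by apply/funext => x /=; rewrite powR_inv1.
by apply: measurableT_comp => //; exact: measurable_powR.
Qed.

Lemma measurable_fun_sqrt D f : (forall x, 0 <= f x) -> measurable_fun D f ->
  measurable_fun D (fun x => Num.sqrt (f x)).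
Proof.
move=> f0 mf; rewrite (_ : (fun x => _) = (@powR R ^~ (2^-1)) \o f); last first.
  by apply/funext => x /=; rewrite powR12_sqrt.
by apply: measurableT_comp => //; exact: measurable_powR.
Qed.

Lemma measurable_set_le f g : measurable_fun setT f -> measurable_fun setT g ->
  measurable [set x | f x <= g x].
Proof.
move=> mf mg; rewrite -[X in measurable X]setTI.
exact: (measurable_fun_ler mf mg measurableT (Y := [set true])).
Qed.

Lemma measurable_set_lt f g : measurable_fun setT f -> measurable_fun setT g ->
  measurable [set x | f x < g x].
Proof.
move=> mf mg; rewrite -[X in measurable X]setTI.
exact: (measurable_fun_ltr mf mg measurableT (Y := [set true])).
Qed.

Lemma measurable_poisson D (f1 f2 g1 g2 : T -> R) :
  measurable_fun D f1 -> measurable_fun D f2 ->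
  measurable_fun D g1 -> measurable_fun D g2 ->
  measurable_fun D (fun x => poisson (f1 x, f2 x) (g1 x, g2 x)).
Proof.
move=> mf1 mf2 mg1 mg2; rewrite /poisson /=; apply: measurable_funM.
  by apply: measurable_funB => //; apply: measurable_funD; exact: measurable_funX.
apply: measurable_fun_inv => [x|]; first by rewrite addr_ge0 ?sqr_ge0.
apply: measurable_funD; apply: measurable_funX; apply: measurable_funB => //;
  first apply: measurable_funD; exact: measurable_funM.
Qed.

End General.

Lemma measurable_rad : measurable_fun setT (@rad R).
Proof.
apply: measurable_fun_sqrt => [x|]; first by rewrite addr_ge0 ?sqr_ge0.
by apply: measurable_funD; apply: measurable_funX;
  [exact: measurable_fst|exact: measurable_snd].
Qed.

Lemma measurable_ang : measurable_fun setT (@ang R).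
Proof.
have ma : measurable_fun setT (fun z : R * R => clipped_acos (z.1 / rad z)).
  apply: (@measurableT_comp _ _ _ _ _ _ (@clipped_acos R)).
    by apply: nonincreasing_measurable => //; exact: clipped_acos_nonincreasing.
  apply: measurable_funM; first exact: measurable_fst.
  by apply: measurable_fun_inv; [exact: rad_ge0|exact: measurable_rad].
apply: measurable_fun_ifT => //.
  by apply: measurable_fun_ler => //; exact: measurable_snd.
exact: measurable_funN.
Qed.

Lemma measurable_disc : measurable (@disc R).
Proof.
rewrite (_ : disc (R := R) = [set z | rad z < 1]); last by apply/seteqP; split => z /discE.
by apply: measurable_set_lt => //; exact: measurable_rad.
Qed.

Lemma measurable_sin : measurable_fun setT (@sin R).
Proof. by apply: continuous_measurable_fun; exact: continuous_sin. Qed.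

Lemma measurable_cos : measurable_fun setT (@cos R).
Proof. by apply: continuous_measurable_fun; exact: continuous_cos. Qed.

Lemma measurable_sector (h t : R) : 0 < h -> h <= 1 -> measurable (sector h t).
Proof.
move=> h0 h1.
rewrite (_ : sector h t = [set z | 1 - h <= rad z] `&` [set z | rad z < 1] `&`
   [set z | rad z * cos h <= rad z * cos (ang z - t)]); last first.
  apply/seteqP; split => z; first by move=> /(sectorP _ _ h0 h1)[].
  by move=> [[? ?] ?]; apply/(sectorP _ _ h0 h1).
have mr := measurable_rad.
apply: measurableI; first apply: measurableI.
- exact: measurable_set_le.
- exact: measurable_set_lt.
- apply: measurable_set_le; first exact: measurable_funM.
  apply: measurable_funM => //; apply: measurableT_comp; first exact: measurable_cos.
  by apply: measurable_funB => //; exact: measurable_ang.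
Qed.

Lemma poisson_ge0 (z w : R * R) : disc z -> 0 <= poisson z w.
Proof.
by rewrite /disc /= => zD; apply: divr_ge0; [lra|by rewrite addr_ge0 ?sqr_ge0].
Qed.

(** Tonelli asks for a nonnegative integrand on the whole product, so the integrand is set to 0
    outside the disc, where the kernel may be negative. *)
Lemma measurable_pext (u : R -> R) : measurable_fun setT u -> (forall t, 0 <= u t) ->
  measurable_fun (@disc R) (pext u).
Proof.
move=> mu u0.
pose D : set ((R * R) * R) := (@disc R) `*` `[- pi, pi].
have mD : measurable D by apply: measurableX => //; exact: measurable_disc.
pose F : (R * R) * R -> \bar R :=
  (fun p => (u p.2 * poisson p.1 (circ p.2))%:E) \_ D.
have mF : measurable_fun setT F.
  apply/(measurable_restrictT _ _).1 => //; apply/measurable_EFinP.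
  apply: measurable_funTS; apply: measurable_funM.
    by apply: measurableT_comp => //; exact: measurable_snd.
  rewrite (_ : (fun x : R * R * R => _) =
    (fun x => poisson (x.1.1, x.1.2) (cos x.2, sin x.2))); last first.
    by apply/funext => -[[a b] c].
  apply: measurable_poisson.
  - exact: (measurableT_comp measurable_fst measurable_fst).
  - exact: (measurableT_comp measurable_snd measurable_fst).
  - exact: (measurableT_comp measurable_cos measurable_snd).
  - exact: (measurableT_comp measurable_sin measurable_snd).
have F0 p : (0 <= F p)%E.
  rewrite /F /patch; case: ifPn => // /[!inE] -[zD _].
  by rewrite lee_fin mulr_ge0// poisson_ge0.
have mI := @measurable_fun_fubini_tonelli_F _ _ _ (measurableTypeR R) R (@lebesgue_measure R) F mF F0.
rewrite (_ : pext u = fun z => (2 * pi)^-1 *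
    fine (\int[@lebesgue_measure R]_(t in `[(- pi)%R, pi%R]) (u t * poisson z (circ t))%:E)); last by [].
apply: measurable_funM => //.
apply: (eq_measurable_fun (fun z => fine (fubini_F (@lebesgue_measure R) F z))).
  move=> z /[!inE] zD; congr fine; rewrite /fubini_F [RHS]integral_mkcond.
  apply: eq_integral => t _; rewrite /F /patch /= /D.
  congr (if _ then _ else _).
  by apply/idP/idP; rewrite !inE /=; [case|].
apply: measurableT_comp; last exact: measurable_funTS.
exact: fine_measurable.
Qed.

End Measurability.

(** * Poisson extensions against masses of arcs *)

Section PoissonExtension.
Variable R : realType.
Local Notation leb := (@lebesgue_measure R).
Implicit Types (u g : R -> R) (r t x H : R).

Lemma imass_period (v : R -> \bar R) t : periodic_density v ->
  imass v (- pi) pi = imass v (t - pi) (t + pi).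
Proof.
move=> hv; rewrite !rmassK//; congr EFin.
have := ifun_period (t - pi) (rmass_interval_function hv).
by rewrite (_ : t - pi + 2 * pi = t + pi); [move=> ->|ring].
Qed.

(** Serves boundary points ([s = 1]) and interior points alike. Outside level [m] the inverse
    denominator is at most [32 * 4^m]; the summation costs 4 and [1 - r^2 <= 2 * (1 - r)] costs 2,
    which makes [16 * 16]. *)
Lemma kernel_bound (r s c : R) (n : nat) (b : nat -> bool) :
  0 <= r -> r < 1 -> 0 <= s -> s <= 1 -> c <= 1 -> 2^-1 ^+ n <= 2 * (1 - r) ->
  (forall m, ~~ b m -> s < 1 - 2^-1 ^+ m \/ c <= cos (2^-1 ^+ m)) ->
  (1 - r ^+ 2) / ((1 - r * s) ^+ 2 + 2 * (r * s) * (1 - c)) <=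
  (16 * 16) * (1 - r) * (1 + \sum_(m < n.+1) 4 ^+ m * (b m)%:R).
Proof.
move=> r0 r1 s0 s1 c1 hn hb.
set D := (X in _ / X <= _); set Q := (X in _ <= _ * X).
have p0 := @expV2_gt0 R.
have p1 := @expV2_le1 R.
have q := @sqr_expV2 R.
have D1 : (1 - r) ^+ 2 <= D.
  have rs : r * s <= r by rewrite ler_piMr.
  have : (1 - r) ^+ 2 <= (1 - r * s) ^+ 2 by rewrite ler_sqr ?nnegrE; lra.
  have : 0 <= 2 * (r * s) * (1 - c) by rewrite !mulr_ge0//; lra.
  by rewrite /D; lra.
have D0 : 0 < D by apply: lt_le_trans D1; rewrite exprn_gt0//; lra.
have k m : (2^-1 ^+ m) ^+ 2 / 32 <= D -> D^-1 <= 32 * 4 ^+ m.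
  move=> h; rewrite -[leLHS]mul1r ler_pdivrMr//.
  have f0 : 0 <= 4 ^+ m :> R by rewrite exprn_ge0.
  by have := ler_wpM2l f0 h; rewrite mulrA q; lra.
have : D^-1 <= 4 * 32 * Q.
  apply: dyadic_kernel_bound => //; last first.
    apply: k; apply: le_trans D1.
    have : (2^-1 ^+ n) ^+ 2 <= (2 * (1 - r)) ^+ 2 by rewrite ler_sqr ?nnegrE; have := p0 n; lra.
    by have := sqr_ge0 (1 - r); rewrite exprMn; lra.
  by move=> m /hb bm; apply: k; exact: poisson_den_ge.
move=> h; have r2 : 0 <= 1 - r ^+ 2 by rewrite subr_ge0 expr_le1// ltW.
have Q0 : 0 <= Q by rewrite addr_ge0// sumr_ge0// => m _; rewrite mulr_ge0// exprn_ge0.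
apply: le_trans (ler_wpM2l r2 h) _.
have : (1 - r ^+ 2) * Q <= 2 * (1 - r) * Q by rewrite ler_wpM2r//; nra.
lra.
Qed.

Lemma circ_periodic t : circ (t + 2 * pi) = circ t :> R * R.
Proof. by rewrite /circ (_ : 2 * pi = pi *+ 2) ?cosD2pi ?sinD2pi// mulr_natl. Qed.

Lemma poisson_circ_le r x t : 0 <= r -> r < 1 ->
  poisson (r * cos x, r * sin x) (circ t) <= 2 / (1 - r).
Proof.
move=> r0 r1; rewrite poisson_circ.
have c1 := cos_le1 (t - x).
have D1 : (1 - r) ^+ 2 <= (1 - r) ^+ 2 + 2 * r * (1 - cos (t - x)).
  by rewrite lerDl !mulr_ge0//; lra.
have D0 : 0 < (1 - r) ^+ 2 by rewrite exprn_gt0//; lra.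
rewrite ler_pdivrMr ?(lt_le_trans D0)//.
apply: (@le_trans _ _ (2 / (1 - r) * (1 - r) ^+ 2)); last first.
  by rewrite ler_wpM2l// divr_ge0//; lra.
by rewrite expr2 mulrA divfK; [nra|rewrite gt_eqF//; lra].
Qed.

Lemma disc_polar r x : 0 <= r -> r < 1 -> disc (r * cos x, r * sin x).
Proof. by move=> r0 r1; apply/discE; rewrite rad_polar. Qed.

Lemma poisson_density u r x : periodic_density (EFin \o u) -> 0 <= r -> r < 1 ->
  periodic_density (fun t => (u t * poisson (r * cos x, r * sin x) (circ t))%:E).
Proof.
move=> hu r0 r1; have [mu u0 up uf] := hu.
have P0 t : 0 <= poisson (r * cos x, r * sin x) (circ t).
  by apply: poisson_ge0; exact: disc_polar.
have u0' t : 0 <= u t by have := u0 t; rewrite lee_fin.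
have m : measurable_fun setT
    (fun t => (u t * poisson (r * cos x, r * sin x) (circ t))%:E).
  apply/measurable_EFinP/measurable_funM; first exact/measurable_EFinP.
  by apply: measurable_poisson => //; [exact: measurable_cos|exact: measurable_sin].
split => //.
- by move=> t; rewrite lee_fin mulr_ge0.
- by move=> t; rewrite circ_periodic; have [->] := up t.
apply: (@le_lt_trans _ _ ((2 / (1 - r))%:E * imass (EFin \o u) (- pi) pi)%E).
  rewrite /imass -ge0_integralZl_EFin//; last 2 first.
  - exact: measurable_funTS.
  - by rewrite divr_ge0//; lra.
  apply: ge0_le_integral => //.
  - by move=> t _; rewrite lee_fin mulr_ge0.
  - exact: measurable_funTS.
  - by apply: measurable_funeM; exact: measurable_funTS.
  - by move=> t _; rewrite -EFinM lee_fin mulrC ler_wpM2r// poisson_circ_le.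
by rewrite rmassK// -EFinM ltry.
Qed.

Lemma pextE u r x : periodic_density (EFin \o u) -> 0 <= r -> r < 1 ->
  pext u (r * cos x, r * sin x) = (2 * pi)^-1 *
  rmass (fun t => (u t * poisson (r * cos x, r * sin x) (circ t))%:E) (x - pi) (x + pi).
Proof.
move=> hu r0 r1; have hv := poisson_density x hu r0 r1.
by rewrite /rmass -imass_period.
Qed.

Lemma pext_ge0 u (z : R * R) : periodic_density (EFin \o u) -> disc z -> 0 <= pext u z.
Proof.
move=> [_ u0 _ _] zD; rewrite /pext mulr_ge0 ?invr_ge0 ?mulr_ge0 ?pi_ge0//.
apply: Rintegral_ge0 => t _; rewrite mulr_ge0 ?poisson_ge0//.
by have := u0 t; rewrite lee_fin.
Qed.

(** The kernel bound at [s = 1] is integrated over the period centred at [x], where the cosine is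
    monotone in [|t - x| <= pi]. Its constant term yields the mass of a full period. *)
Lemma pext_le u r x n : periodic_density (EFin \o u) -> 0 <= r -> r < 1 ->
  2^-1 ^+ n <= 2 * (1 - r) ->
  pext u (r * cos x, r * sin x) <= (16 * 16) * (1 - r) *
    (rmass (EFin \o u) (x - pi) (x + pi) +
     \sum_(m < n.+1) 4 ^+ m * rmass (EFin \o u) (x - 2^-1 ^+ m) (x + 2^-1 ^+ m)).
Proof.
move=> hu r0 r1 hn; rewrite pextE//.
have hv := poisson_density x hu r0 r1.
have [mu u0 up uf] := hu; have [mv v0 vp vf] := hv.
set v := (fun t => _) in hv mv v0 vp vf *.
have u0' t : 0 <= u t by have := u0 t; rewrite lee_fin.
have pi2 := @pi_ge2 R.
pose I m : set R := `[x - 2^-1 ^+ m, x + 2^-1 ^+ m]%classic.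
have p0 := @expV2_gt0 R.
have p1 := @expV2_le1 R.
have f0 m : 0 <= 4 ^+ m :> R by rewrite exprn_ge0.
set RH := (16 * 16) * (1 - r) * _.
have c0 : 0 <= (16 * 16) * (1 - r) by rewrite mulr_ge0//; lra.
have D0 : measurable (`[x - pi, x + pi] : set R) by [].
have mI m : measurable_fun setT ((EFin \o u) \_ (I m)).
  by apply/(measurable_restrictT _ _).1; [exact: measurable_itv|exact: measurable_funTS].
have I0 m t : (0 <= ((EFin \o u) \_ (I m)) t)%E by apply: erestrict_ge0 => ? _.
have main : rmass v (x - pi) (x + pi) <= RH.
  rewrite -lee_fin -rmassK//.
  pose k t : \bar R :=
    ((EFin \o u) t + \sum_(m < n.+1) (4 ^+ m)%:E * ((EFin \o u) \_ (I m)) t)%E.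
  have pt (t : R) : x - pi <= t <= x + pi -> (v t <= ((16 * 16) * (1 - r))%:E * k t)%E.
    move=> /andP[t1 t2]; rewrite /k.
    have -> : (\sum_(m < n.+1) (4 ^+ m)%:E * ((EFin \o u) \_ (I m)) t)%E =
        (u t * \sum_(m < n.+1) 4 ^+ m * (`|t - x| <= 2^-1 ^+ m)%R%:R)%:E.
      rewrite mulr_sumr -sumEFin; apply: eq_bigr => m _.
      rewrite /patch /I mem_setE in_itv/= ler_distl; case: ifP => _ /=.
        by rewrite mulr1 mulrC EFinM.
      by rewrite mulr0 mulr0 mule0.
    rewrite /v -[((EFin \o u) t)]/((u t)%:E) -EFinD -EFinM lee_fin.
    set Q := \sum_(m < n.+1) _.
    have -> : (16 * 16) * (1 - r) * (u t + u t * Q) = u t * ((16 * 16) * (1 - r) * (1 + Q)) by ring.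
    rewrite ler_wpM2l//.
    rewrite poisson_circ -[X in X <= _](_ : (1 - r ^+ 2) /
      ((1 - r * 1) ^+ 2 + 2 * (r * 1) * (1 - cos (t - x))) = _); last by rewrite !mulr1.
    apply: (@kernel_bound r 1 (cos (t - x)) n (fun m => `|t - x| <= 2^-1 ^+ m)) => //.
    move=> m; rewrite -ltNge => lt; right.
    have -> : cos (t - x) = cos `|t - x|.
      by case: (ger0P (t - x)) => _; rewrite ?cosN.
    apply: ler_cos; [exact: ltW|exact: ltW|].
    by rewrite ler_norml; apply/andP; split; lra.
  apply: (@le_trans _ _ (\int[leb]_(t in `[(x - pi)%R, (x + pi)%R])
     (((16 * 16) * (1 - r))%:E * k t))%E).
    apply: ge0_le_integral => //.
    - by move=> t _; exact: v0.
    - exact: measurable_funTS.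
    - apply: measurable_funeM; apply: emeasurable_funD; first exact: measurable_funTS.
      apply: emeasurable_sum => m; apply: measurable_funeM; apply: measurable_funTS; exact: mI.
  have k0 t : (0 <= k t)%E.
    by rewrite adde_ge0// sume_ge0// => m _; rewrite mule_ge0// lee_fin.
  have mS : measurable_fun `[x - pi, x + pi]
      (fun t => (\sum_(m < n.+1) (4 ^+ m)%:E * ((EFin \o u) \_ (I m)) t)%E).
    apply: emeasurable_sum => m; apply: measurable_funeM; apply: measurable_funTS; exact: mI.
  have mk : measurable_fun `[x - pi, x + pi] k.
    by apply: emeasurable_funD => //; exact: measurable_funTS.
  rewrite ge0_integralZl_EFin// /k.
  rewrite (@ge0_integralD _ _ _ leb _ _ (EFin \o u))//; last 2 first.
  - exact: measurable_funTS.
  - by move=> t _; rewrite sume_ge0// => m _; rewrite mule_ge0// lee_fin.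
  rewrite ge0_integral_sum//; last 2 first.
  - by move=> m; apply: measurable_funeM; apply: measurable_funTS; exact: mI.
  - by move=> m t _; rewrite mule_ge0// lee_fin.
  rewrite /RH [((16 * 16) * (1 - r) * _)%:E]EFinM lee_wpmul2l ?lee_fin// EFinD leeD//.
    by rewrite -rmassK.
  rewrite -sumEFin; apply: lee_sum => m _.
  rewrite ge0_integralZl_EFin//; last by apply: measurable_funTS; exact: mI.
  rewrite EFinM lee_wpmul2l ?lee_fin// -rmassK// -integral_mkcondr.
  apply: ge0_subset_integral => //; last exact: measurable_funTS.
  by apply: measurableI => //; exact: measurable_itv.
apply: le_trans main.
rewrite ler_piMl//; first by rewrite fine_ge0// imass_ge0.
by rewrite invf_le1; lra.
Qed.

(** On the arc of half-width [H] the denominator is at most [H^2 + H^2] and the numerator at least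
    [1 - r]. *)
Lemma pext_ge u r x H : periodic_density (EFin \o u) -> 0 <= r -> r < 1 ->
  1 - r <= H -> H <= pi ->
  (1 - r) / (2 * H ^+ 2) * rmass (EFin \o u) (x - H) (x + H) <=
  2 * pi * pext u (r * cos x, r * sin x).
Proof.
move=> hu r0 r1 rH Hp; rewrite pextE// mulVKf; last first.
  by rewrite gt_eqF// mulr_gt0// pi_gt0.
have hv := poisson_density x hu r0 r1.
have [mu u0 up uf] := hu; have [mv v0 vp vf] := hv.
set v := (fun t => _) in hv mv v0 vp vf *.
have u0' t : 0 <= u t by have := u0 t; rewrite lee_fin.
have H0 : 0 < H by lra.
have c0 : 0 <= (1 - r) / (2 * H ^+ 2).
  by rewrite divr_ge0 ?mulr_ge0 ?sqr_ge0//; lra.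
apply: (@le_trans _ _ (rmass v (x - H) (x + H))); last first.
  by apply: ifun_mono (rmass_interval_function hv) _ _ _; lra.
rewrite -lee_fin EFinM -!rmassK// /imass -ge0_integralZl_EFin//; last first.
  exact: measurable_funTS.
have pt (t : R) : x - H <= t <= x + H ->
    (((1 - r) / (2 * H ^+ 2))%:E * (EFin \o u) t <= v t)%E.
  rewrite -ler_distl => tH.
  rewrite /v -EFinM lee_fin mulrC ler_wpM2l// poisson_circ.
  have c1 := cos_le1 (t - x); have c2 := one_sub_cos_le (t - x).
  have t2 : (t - x) ^+ 2 <= H ^+ 2.
    by rewrite -[leLHS]real_normK ?num_real// ler_sqr ?nnegrE//; lra.
  have r2 : (1 - r) ^+ 2 <= H ^+ 2 by rewrite ler_sqr ?nnegrE; lra.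
  have D1 : (1 - r) ^+ 2 + 2 * r * (1 - cos (t - x)) <= 2 * H ^+ 2.
    have : r * (1 - cos (t - x)) <= 1 * (1 - cos (t - x)) by rewrite ler_wpM2r; lra.
    lra.
  have D0 : 0 < (1 - r) ^+ 2 + 2 * r * (1 - cos (t - x)).
    by rewrite ltr_wpDr ?mulr_ge0 ?exprn_gt0//; lra.
  apply: ler_pM; [lra|by rewrite invr_ge0 mulr_ge0 ?sqr_ge0|nra|].
  by rewrite lef_pV2 ?posrE// mulr_gt0// exprn_gt0.
apply: ge0_le_integral => //.
- by move=> t _; rewrite mule_ge0 ?lee_fin.
- by apply: measurable_funeM; exact: measurable_funTS.
- exact: measurable_funTS.
Qed.

Lemma integrable_poisson u g (z : R * R) : periodic_density (EFin \o g) ->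
  measurable_fun setT u -> (forall t, `|u t| <= g t) -> disc z ->
  leb.-integrable `[(- pi)%R, pi%R] (EFin \o (fun t => u t * poisson z (circ t))).
Proof.
move=> hg mu ug zD; have [mg g0 _ _] := hg.
have r1 : rad z < 1 by apply/discE.
have := poisson_density (ang z) hg (rad_ge0 z) r1; rewrite -polarE => -[mv v0 _ vf].
have P0 t : 0 <= poisson z (circ t) by exact: poisson_ge0.
have ig : leb.-integrable `[(- pi)%R, pi%R] (EFin \o (fun t => g t * poisson z (circ t))).
  apply/integrableP; split; first exact: measurable_funTS.
  apply: le_lt_trans vf; rewrite le_eqVlt; apply/orP; left; apply/eqP.
  by apply: eq_integral => t _; rewrite gee0_abs//; exact: v0.
have mP : measurable_fun setT (fun t => poisson z (circ t)).
  case: (z) => a b; apply: measurable_poisson => //; [exact: measurable_cos|exact: measurable_sin].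
apply: le_integrable ig => //.
  by apply: measurable_funTS; apply/measurable_EFinP; exact: measurable_funM.
move=> t _ /=; rewrite lee_fin !normrM ler_wpM2r//.
by rewrite (le_trans (ug t))// ler_norm.
Qed.

Lemma normr_pext_le u g (z : R * R) : periodic_density (EFin \o g) ->
  measurable_fun setT u -> (forall t, `|u t| <= g t) -> disc z ->
  `|pext u z| <= pext g z.
Proof.
move=> hg mu ug zD; have [mg g0 _ _] := hg.
have iu := integrable_poisson hg mu ug zD.
have P0 t : 0 <= poisson z (circ t) by exact: poisson_ge0.
have ig : leb.-integrable `[(- pi)%R, pi%R] (EFin \o (fun t => g t * poisson z (circ t))).
  apply: (integrable_poisson hg) => //; first exact/measurable_EFinP.
  by move=> t; rewrite ger0_norm//; have := g0 t; rewrite lee_fin.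
rewrite /pext normrM ger0_norm ?invr_ge0 ?mulr_ge0 ?pi_ge0//.
rewrite ler_wpM2l ?invr_ge0 ?mulr_ge0 ?pi_ge0//.
apply: le_trans (le_normr_Rintegral _ _) _ => //.
apply: le_Rintegral => //.
  by apply: integrable_norm.
by move=> t _; rewrite normrM [`|poisson _ _|]ger0_norm// ler_wpM2r.
Qed.

(** Difference of the extensions of [u + g] and [g], both nonnegative. *)
Lemma measurable_pext_dominated u g : periodic_density (EFin \o g) ->
  measurable_fun setT u -> (forall t, `|u t| <= g t) ->
  measurable_fun (@disc R) (pext u).
Proof.
move=> hg mu ug; have [mg g0 _ _] := hg; have {}mg : measurable_fun setT g by exact/measurable_EFinP.
have {}g0 t : 0 <= g t by have := g0 t; rewrite lee_fin.
have gg t : `|g t| <= g t by rewrite ger0_norm.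
apply: (eq_measurable_fun (fun z => pext (fun t => u t + g t) z - pext g z)); last first.
  apply: measurable_funB; apply: measurable_pext => //; first exact: measurable_funD.
  by move=> t; have := ug t; rewrite ler_norml => /andP[h _]; rewrite -lerBlDr sub0r.
move=> z; rewrite inE => zD.
have iu := integrable_poisson hg mu ug zD; have ig := integrable_poisson hg mg gg zD.
rewrite /pext -mulrBr; congr (_ * _).
under eq_Rintegral do rewrite mulrDl.
by rewrite RintegralD// addrK.
Qed.

End PoissonExtension.

(** * From A_2 weights to pairs of interval functions *)

Section WeightsOfClassA2.
Variable R : realType.
Local Notation leb := (@lebesgue_measure R).
Implicit Types (mu g : R -> R).

Lemma measurable_einv mu : measurable_fun setT mu -> (forall t, 0 <= mu t) ->
  measurable_fun setT (einv mu).
Proof.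
move=> mmu mu0; apply: measurable_fun_ifT => //.
  exact: measurable_fun_eqr.
by apply/measurable_EFinP; exact: measurable_fun_inv.
Qed.

Lemma einv_ge0 mu : (forall t, 0 <= mu t) -> forall t, (0 <= einv mu t)%E.
Proof. by move=> mu0 t; rewrite /einv; case: ifP => // _; rewrite lee_fin invr_ge0. Qed.

Lemma A2_density mu : A2 mu ->
  periodic_density (EFin \o mu) /\ periodic_density (einv mu).
Proof.
move=> [mmu mu0 pmu [K hK]]; have pi0 := @pi_gt0 R.
have [f1 f2 _] := hK (- pi) pi ltac:(lra) ltac:(lra).
split; split => //.
- exact/measurable_EFinP.
- by move=> t /=; rewrite pmu.
- exact: measurable_einv.
- exact: einv_ge0.
- by move=> t; rewrite /einv pmu.
Qed.

(** Where [mu] vanishes the right side is [+oo]; elsewhere the two sides differ by a square over a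
    positive number. *)
Lemma AMGM_einv mu g (s t : R) : 0 <= mu t -> 0 <= g t -> 0 < s ->
  ((g t)%:E <= (s / 2)%:E * einv mu t + ((2 * s)^-1)%:E * (g t ^+ 2 * mu t)%:E)%E.
Proof.
move=> m0 g0 s0; rewrite /einv; have [e|ne] := eqVneq (mu t) 0.
  rewrite gt0_muley ?lte_fin; last lra.
  by rewrite addye ?leey.
have mp : 0 < mu t by rewrite lt_def ne.
rewrite -!EFinM -EFinD lee_fin -subr_ge0.
have -> : s / 2 / mu t + (2 * s)^-1 * (g t ^+ 2 * mu t) - g t =
  (s - g t * mu t) ^+ 2 / (2 * s * mu t).
  by field; rewrite !gt_eqF.
by rewrite divr_ge0 ?sqr_ge0// !mulr_ge0// ltW.
Qed.

(** Integrability of [1 / mu] makes functions of the weighted space integrable, so their Poisson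
    extensions are genuine integrals: [AMGM_einv] with [s = 1]. *)
Lemma density_of_weighted_L2 mu g : A2 mu -> measurable_fun setT g ->
  (forall t, 0 <= g t) -> periodic2pi g ->
  periodic_density (fun t => (g t ^+ 2 * mu t)%:E) -> periodic_density (EFin \o g).
Proof.
move=> hmu mg g0 gp hY; have [hW hS] := A2_density hmu.
have [mS S0 _ fS] := hS; have [mY Y0 _ fY] := hY; have [_ mu0 _ _] := hmu.
split => //; [exact/measurable_EFinP|by move=> t /=; rewrite gp|].
apply: (@le_lt_trans _ _ (imass (fun t => (1 / 2)%:E * einv mu t +
    ((2 * 1)^-1)%:E * (g t ^+ 2 * mu t)%:E) (- pi) pi)%E).
  apply: ge0_le_integral => //.
  - by move=> t _; rewrite lee_fin.
  - by apply: measurable_funTS; exact/measurable_EFinP.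
  - by apply: measurable_funTS; apply: emeasurable_funD; exact: measurable_funeM.
  - by move=> t _; exact: AMGM_einv.
rewrite /imass ge0_integralD//; last 4 first.
- by move=> t _; rewrite mule_ge0.
- by apply: measurable_funTS; exact: measurable_funeM.
- by move=> t _; rewrite mule_ge0// lee_fin// invr_ge0; lra.
- by apply: measurable_funTS; exact: measurable_funeM.
rewrite !ge0_integralZl_EFin//; [|exact: measurable_funTS..].
have := rmassK (- pi) pi hS; have := rmassK (- pi) pi hY; rewrite /imass => -> ->.
by rewrite -!EFinM -EFinD ltry.
Qed.

Lemma weighted_cauchy_schwarz mu g (a b : R) : A2 mu -> (forall t, 0 <= g t) ->
  periodic_density (EFin \o g) -> periodic_density (fun t => (g t ^+ 2 * mu t)%:E) ->
  rmass (EFin \o g) a b ^+ 2 <=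
  rmass (einv mu) a b * rmass (fun t => (g t ^+ 2 * mu t)%:E) a b.
Proof.
move=> hmu g0 hg hY; have [hW hS] := A2_density hmu; have [_ mu0 _ _] := hmu.
by apply: sqr_rmass_le => // s t s0; exact: AMGM_einv.
Qed.

Lemma imass1 (a b : R) : a <= b -> imass (fun=> 1%E) a b = (b - a)%:E.
Proof.
move=> ab; rewrite /imass integral_cst//= mul1e lebesgue_measure_itv/= lte_fin.
case: ltP => // ba; have -> : a = b by apply/eqP; rewrite eq_le ab ba.
by rewrite subrr.
Qed.

Lemma A2_pairP mu : A2 mu ->
  exists K, A2_pair K (rmass (EFin \o mu)) (rmass (einv mu)).
Proof.
move=> hmu; have [hW hS] := A2_density hmu; have [mmu mu0 pmu [K hK]] := hmu.
exists (64 * K); apply: A2_pair_extend.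
- exact: rmass_interval_function.
- exact: rmass_interval_function.
- move=> a b ab ba; have [_ _] := hK a b ab ba.
  rewrite -/(rmass (EFin \o mu) a b) -/(rmass (einv mu) a b).
  have l0 : 0 < b - a by rewrite subr_gt0.
  rewrite mulrACA -invfM -expr2 => h.
  have := ler_wpM2l (sqr_ge0 (b - a)) h.
  by rewrite mulVKf ?gt_eqF ?exprn_gt0// [_ * K]mulrC.
(* Cauchy-Schwarz for the constant function 1. *)
- move=> a b ab.
  have h1 : periodic_density (EFin \o (fun=> 1 : R)).
    have pi0 := @pi_gt0 R; split => //; first exact: measurable_cst.
    by rewrite (_ : EFin \o _ = fun=> 1%E)// imass1 ?ltry//; lra.
  have e : (fun t => (1 ^+ 2 * mu t)%:E) = EFin \o mu.
    by apply/funext => t /=; rewrite expr1n mul1r.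
  have := @weighted_cauchy_schwarz mu (fun=> 1) a b hmu (fun=> ler01) h1.
  rewrite e => /(_ hW); rewrite /rmass (_ : EFin \o (fun=> 1) = fun=> 1%E)//.
  by rewrite imass1 ?(ltW ab)//= mulrC.
Qed.

(** Doubling compares a period with the arc of half-width 1, the term [m = 0]; the ratio of lengths
    is [pi <= 4], whence [16 * K]. *)
Lemma A2_tail_period K W S (t : R) n : A2_pair K W S ->
  W (t - pi) (t + pi) + \sum_(m < n.+1) 4 ^+ m * W (t - 2^-1 ^+ m) (t + 2^-1 ^+ m) <=
  (1 + 16 * K) * (16 * K ^+ 2) * (4 ^+ n * W (t - 2^-1 ^+ n) (t + 2^-1 ^+ n)).
Proof.
move=> h; have K1 := A2_pair_ge1 h; have tl := A2_tail t n h.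
have pi2 := @pi_ge2 R; have pi4 := @pi_lt4 R.
have d := A2_doubling (a := t - 1) (b := t + 1) (a' := t - pi) (b' := t + pi) h
  ltac:(lra) ltac:(lra) ltac:(lra) ltac:(lra).
have w0 : 0 < W (t - 1) (t + 1) by apply: A2_pair_gt0 h _; lra.
have hS : W (t - 1) (t + 1) <= \sum_(m < n.+1) 4 ^+ m * W (t - 2^-1 ^+ m) (t + 2^-1 ^+ m).
  rewrite big_ord_recl /= !expr0 mul1r lerDl sumr_ge0// => m _.
  rewrite mulr_ge0 ?exprn_ge0//; have [[W0 _ _] _ _ _] := h; apply: W0.
  by have := exprn_gt0 (bump 0 m) (_ : 0 < 2^-1 :> R); rewrite invr_gt0 => /(_ ltac:(lra)); lra.
set Sm := \sum_(m < n.+1) _ in tl hS *.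
have p16 : pi ^+ 2 <= 16 :> R by rewrite expr2; nra.
have d' : W (t - pi) (t + pi) <= 16 * K * W (t - 1) (t + 1).
  have -> : W (t - pi) (t + pi) = W (t - pi) (t + pi) * (t + 1 - (t - 1)) ^+ 2 / 4 by field.
  rewrite ler_pdivrMr//; apply: le_trans d _.
  have -> : K * (t + pi - (t - pi)) ^+ 2 * W (t - 1) (t + 1) =
    4 * (K * W (t - 1) (t + 1)) * pi ^+ 2 by ring.
  have -> : 16 * K * W (t - 1) (t + 1) * 4 = 4 * (K * W (t - 1) (t + 1)) * 16 by ring.
  by rewrite ler_wpM2l// !mulr_ge0//; [lra|exact: ltW].
have : 16 * K * W (t - 1) (t + 1) <= 16 * K * Sm by rewrite ler_wpM2l//; lra.
have := ler_wpM2l (_ : 0 <= 1 + 16 * K) tl; rewrite -mulrA => /(_ ltac:(lra)).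
lra.
Qed.

End WeightsOfClassA2.

(** * Integration of bounds by sums of indicators *)

Section WeightedIntegrals.
Context d (T : measurableType d) (R : realType).
Variables (nu : {measure set T -> \bar R}) (D : set T) (f : T -> R).
Hypotheses (mD : measurable D) (mf : measurable_fun D f).
Hypothesis f0 : forall x, D x -> 0 <= f x.

Lemma integral_le_weighted_sum (A : set T) (phi : T -> R) (n : nat)
    (c : nat -> R) (S : nat -> set T) :
  measurable A -> A `<=` D -> measurable_fun A phi ->
  (forall x, A x -> 0 <= phi x) -> (forall l, 0 <= c l) ->
  (forall l, measurable (S l)) -> (forall l, S l `<=` D) ->
  (forall x, A x -> phi x <= \sum_(l < n) c l * \1_(S l) x) ->
  (\int[nu]_(x in A) (phi x * f x)%:E <=
   \sum_(l < n) (c l)%:E * \int[nu]_(x in S l) (f x)%:E)%E.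
Proof.
move=> mA AD mphi phi0 c0 mS SD H.
have mfE : measurable_fun D (EFin \o f) by exact/measurable_EFinP.
have mr l : measurable_fun D ((EFin \o f) \_ (S l)).
  apply: measurable_funTS; apply/(measurable_restrictT _ _).1 => //.
  by apply: measurable_funS mfE.
have r0 l x : (0 <= ((EFin \o f) \_ (S l)) x)%E.
  by apply: erestrict_ge0 => y /SD Dy; rewrite lee_fin f0.
apply: (@le_trans _ _ (\int[nu]_(x in D) (\sum_(l < n) (c l)%:E * ((EFin \o f) \_ (S l)) x))%E).
  have mk : measurable_fun D (fun x => \sum_(l < n) (c l)%:E * ((EFin \o f) \_ (S l)) x)%E.
    by apply: emeasurable_sum => l; apply: measurable_funeM; exact: mr.
  have k0 x : (0 <= \sum_(l < n) (c l)%:E * ((EFin \o f) \_ (S l)) x)%E.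
    by rewrite sume_ge0// => l _; rewrite mule_ge0 ?lee_fin//.
  apply: (@le_trans _ _ (\int[nu]_(x in A) (\sum_(l < n) (c l)%:E * ((EFin \o f) \_ (S l)) x))%E);
    last exact: ge0_subset_integral.
  apply: ge0_le_integral => //.
  - by move=> x Ax; rewrite lee_fin mulr_ge0 ?phi0 ?f0//; exact: AD.
  - apply/measurable_EFinP; apply: measurable_funM => //.
    exact: measurable_funS mf.
  - exact: measurable_funS mk.
  - move=> x Ax; have fx : 0 <= f x by apply: f0; exact: AD.
    rewrite (eq_bigr (fun l : 'I_n => (c l * \1_(S l) x * f x)%:E)); last first.
      move=> l _; rewrite /patch indicE; case: ifP => _ /=.
        by rewrite mulr1 EFinM.
      by rewrite mulr0 mul0r mule0.
    by rewrite sumEFin lee_fin -mulr_suml ler_wpM2r// H.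
rewrite ge0_integral_sum//; last 2 first.
- by move=> l; apply: measurable_funeM; exact: mr.
- by move=> l x _; rewrite mule_ge0 ?lee_fin.
apply: lee_sum => l _; rewrite ge0_integralZl_EFin// -integral_mkcondr.
by rewrite (setIidr (@SD l)).
Qed.

Lemma integral_le_cover (A : set T) (n : nat) (S : nat -> set T) :
  measurable A -> A `<=` D ->
  (forall l, measurable (S l)) -> (forall l, S l `<=` D) ->
  (forall x, A x -> exists2 l, (l < n)%N & S l x) ->
  (\int[nu]_(x in A) (f x)%:E <= \sum_(l < n) \int[nu]_(x in S l) (f x)%:E)%E.
Proof.
move=> mA AD mS SD H.
have := @integral_le_weighted_sum A (fun=> 1) n (fun=> 1) S mA AD _ _ _ mS SD.
move=> /(_ _ _ _ _)/wrap[]//.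
- move=> x /H[l ln Slx]; rewrite (bigD1 (Ordinal ln))//= mul1r indicE mem_set//=.
  by rewrite lerDl sumr_ge0// => i _; rewrite mul1r indicE.
- under eq_integral do rewrite mul1r.
  by under eq_bigr do rewrite mul1e.
Qed.

End WeightedIntegrals.

Lemma inv_mul_lt_le (R : realType) (C x : R) (y : \bar R) : 0 < x -> (0 <= y)%E ->
  ((x^-1)%:E * y < C%:E)%E -> (y <= (C * x)%:E)%E.
Proof.
move=> x0 y0; case: y y0 => [y||]//=.
- by rewrite -EFinM lte_fin !lee_fin => y0 h; rewrite -ler_pdivrMr// mulrC ltW.
- by move=> _; rewrite gt0_muley// lte_fin invr_gt0.
Qed.

Lemma le_inv_mul_lt (R : realType) (C x : R) (y : \bar R) : 0 < x -> (0 <= y)%E ->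
  (y <= (C * x)%:E)%E -> ((x^-1)%:E * y < (C + 1)%:E)%E.
Proof.
move=> x0 y0; case: y y0 => [y||]//= _.
rewrite -EFinM lte_fin lee_fin => h.
by rewrite mulrC ltr_pdivrMr// mulrDl mul1r; lra.
Qed.

(** * Kernel condition and sector condition *)

Section CarlesonConditions.
Variables (R : realType) (mu lam : R -> R) (tau : {measure set (R * R)%type -> \bar R}).
Hypotheses (hmu : A2 mu) (hlam : A2 lam).

Local Notation W := (rmass (EFin \o mu)).
Local Notation Lam := (pext lam).
Local Notation disc := (@disc R).

(** (iii) with the quotient cleared and the normalisation [1 / (2 * pi)] absorbed in [D]. *)
Definition sector_carleson (D : R) : Prop :=
  0 <= D /\ forall h t : R, 0 < h -> h <= 1 ->
    (\int[tau]_(w in sector h t) (Lam w)%:E <= (D * W (t - h / 2) (t + h / 2))%:E)%E.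

Definition kernel_carleson (C : R) : Prop :=
  0 <= C /\ forall z, disc z ->
    (\int[tau]_(w in disc) (poisson z w * Lam w)%:E <= (C * pext mu z)%:E)%E.

Lemma mLam : measurable_fun disc Lam.
Proof. by have [? ? _ _] := hlam; exact: measurable_pext. Qed.

Lemma Lam_ge0 z : disc z -> 0 <= Lam z.
Proof. by apply: pext_ge0; have [] := A2_density hlam. Qed.

Lemma measurable_poissonr z D : measurable_fun D (poisson z : R * R -> R).
Proof.
case: z => a b; rewrite (_ : poisson _ = fun w => poisson (a, b) (w.1, w.2)); last first.
  by apply/funext => -[].
by apply: measurable_poisson => //; apply: measurable_funTS;
  [exact: measurable_fst|exact: measurable_snd].
Qed.

(** With [H = 2^-n], [(1 - r) / (2 * H^2) >= 1 / (4 * H)], and [2 * pi < 8] gives [32 = 4 * 8]. *)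
Lemma pext_A2_ge (r x : R) n : 0 <= r -> r < 1 -> 1 - r <= 2^-1 ^+ n ->
  2^-1 ^+ n <= 2 * (1 - r) ->
  W (x - 2^-1 ^+ n) (x + 2^-1 ^+ n) <= 32 * 2^-1 ^+ n * pext mu (r * cos x, r * sin x).
Proof.
move=> r0 r1 n1 n2; have [hW _] := A2_density hmu.
have pi2 := @pi_ge2 R; have pi4 := @pi_lt4 R.
have p1 := @expV2_le1 R n.
have h := pext_ge x hW r0 r1 n1 (_ : 2^-1 ^+ n <= pi); move: (h ltac:(lra)) => {h}.
set H := 2^-1 ^+ n in n1 n2 p1 *; set P := pext _ _ => h.
have H0 : 0 < H by lra.
have W0 : 0 <= W (x - H) (x + H).
  by have [W0 _ _] := rmass_interval_function hW; apply: W0; lra.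
have P0 : 0 <= P by apply: pext_ge0 => //; exact: disc_polar.
have c : (4 * H)^-1 <= (1 - r) / (2 * H ^+ 2).
  rewrite -[leLHS]mul1r ler_pdivrMr; last lra.
  have -> : (1 - r) / (2 * H ^+ 2) * (4 * H) = 2 * (1 - r) / H by field; rewrite gt_eqF.
  by rewrite ler_pdivlMr// mul1r.
have h2 := le_trans (ler_wpM2r W0 c) h.
rewrite mulrC ler_pdivrMr in h2; last lra.
have := ler_wpM2r (mulr_ge0 P0 (ltW H0)) (ltW pi4).
lra.
Qed.

Lemma pext_A2_gt0 z : disc z -> 0 < pext mu z.
Proof.
move=> /discE r1; have r0 := rad_ge0 z; have [K hK] := A2_pairP hmu.
have [n [n1 n2]] := @dyadic_level R (1 - rad z) ltac:(lra) ltac:(lra).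
have := pext_A2_ge (ang z) r0 r1 n1 n2; rewrite -polarE.
have p0 : 0 < 2^-1 ^+ n :> R by lra.
have : 0 < W (ang z - 2^-1 ^+ n) (ang z + 2^-1 ^+ n) by apply: A2_pair_gt0 hK _; lra.
move=> w0 h; have := lt_le_trans w0 h; rewrite pmulr_rgt0//; lra.
Qed.

Lemma pext_A2_le K (r x : R) n : A2_pair K W (rmass (einv mu)) ->
  0 <= r -> r < 1 -> 2^-1 ^+ n <= 2 * (1 - r) ->
  pext mu (r * cos x, r * sin x) <= (16 * 16) * (1 - r) *
    ((1 + 16 * K) * (16 * K ^+ 2) * (4 ^+ n * W (x - 2^-1 ^+ n) (x + 2^-1 ^+ n))).
Proof.
move=> hK r0 r1 hn; have [hW _] := A2_density hmu.
apply: le_trans (pext_le x hW r0 r1 hn) _.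
apply: ler_wpM2l; first by rewrite !mulr_ge0//; lra.
exact: A2_tail_period hK.
Qed.

(** At [z] of modulus [1 - h] in the direction of the sector, the kernel has numerator at least [h]
    and, on the sector, denominator at most [(2 * h)^2 + h^2], so that [5 * h * P_z >= 1] there. *)
Lemma kernel_to_sector C : kernel_carleson C -> exists D, sector_carleson D.
Proof.
move=> [C0 hC]; have [K hK] := A2_pairP hmu; have K1 := A2_pair_ge1 hK.
pose G := (1 + 16 * K) * (16 * K ^+ 2).
have G0 : 0 <= G by rewrite !mulr_ge0 ?sqr_ge0//; lra.
exists ((5 * (16 * 16)) * C * G * (16 * K)); split; first by rewrite !mulr_ge0//; lra.
move=> h t h0 h1; have r0 : 0 <= 1 - h by lra.
have r1 : 1 - h < 1 by lra.
pose z := ((1 - h) * cos t, (1 - h) * sin t).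
have zD : disc z by exact: disc_polar.
have sD := sector_disc (t := t) h0 h1.
have mS : measurable (sector h t) by exact: measurable_sector.
have step : (\int[tau]_(w in sector h t) (Lam w)%:E <=
    (5 * h)%:E * \int[tau]_(w in disc) (poisson z w * Lam w)%:E)%E.
  rewrite -ge0_integralZl_EFin//; last 4 first.
  - exact: measurable_disc.
  - by move=> w wD; rewrite lee_fin; exact: mulr_ge0 (poisson_ge0 w zD) (Lam_ge0 wD).
  - apply/measurable_EFinP; apply: measurable_funM; last exact: mLam.
    exact: measurable_poissonr.
  - lra.
  have mk : measurable_fun disc (fun w => (5 * h)%:E * (poisson z w * Lam w)%:E)%E.
    apply: measurable_funeM; apply/measurable_EFinP; apply: measurable_funM; last exact: mLam.
    exact: measurable_poissonr.
  have k0 w : disc w -> (0 <= (5 * h)%:E * (poisson z w * Lam w)%:E)%E.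
    move=> wD; rewrite -EFinM lee_fin; apply: mulr_ge0; first lra.
    exact: mulr_ge0 (poisson_ge0 w zD) (Lam_ge0 wD).
  apply: (@le_trans _ _ (\int[tau]_(w in sector h t) ((5 * h)%:E * (poisson z w * Lam w)%:E))%E);
    last by apply: ge0_subset_integral => //; exact: measurable_disc.
  apply: ge0_le_integral => //.
  - by move=> w /sD wD; rewrite lee_fin Lam_ge0.
  - apply/measurable_EFinP; apply: measurable_funS mLam => //; exact: measurable_disc.
  - apply: measurable_funS mk => //; exact: measurable_disc.
  move=> w wS; have wD := sD _ wS.
  rewrite -EFinM lee_fin mulrA -[leLHS]mul1r ler_wpM2r ?Lam_ge0//.
  case: wS => s [a [s1 s2 sa ->]]; rewrite /z poisson_polar.
  have c1 := cos_le1 (a - t); have c2 := one_sub_cos_le (a - t).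
  have a2 : (a - t) ^+ 2 <= h ^+ 2.
    by rewrite -[leLHS]real_normK ?num_real// ler_sqr ?nnegrE//; lra.
  have s0 : 0 <= s by lra.
  set p := (1 - h) * s.
  have p0 : 0 <= p by rewrite mulr_ge0.
  have p1 : p <= 1 - h by rewrite ler_piMr//; lra.
  have p2 : 1 - 2 * h <= p.
    have : (1 - h) * (1 - h) <= p by rewrite ler_wpM2l.
    by have := sqr_ge0 h; nra.
  have d1 : (1 - p) ^+ 2 <= (2 * h) ^+ 2 by rewrite ler_sqr ?nnegrE; lra.
  have d2 : p * (1 - cos (a - t)) <= 1 * (1 - cos (a - t)) by rewrite ler_wpM2r; lra.
  have d3 : 0 <= p * (1 - cos (a - t)) by rewrite mulr_ge0//; lra.
  have d4 : 0 < (1 - p) ^+ 2 by rewrite exprn_gt0//; lra.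
  rewrite mulrA ler_pdivlMr; last lra.
  rewrite mul1r; have := sqr_ge0 h; nra.
apply: le_trans step _.
have hz := hC _ zD.
apply: le_trans (lee_wpmul2l _ hz) _; first by rewrite lee_fin; lra.
rewrite -EFinM lee_fin.
have [n [n1 n2]] := dyadic_level h0 h1.
have hz2 := @pext_A2_le K (1 - h) t n hK r0 r1.
rewrite (_ : 1 - (1 - h) = h) in hz2; last lra.
have {}hz2 := hz2 n2; rewrite -/z -/G in hz2.
set Wn := W (t - 2^-1 ^+ n) (t + 2^-1 ^+ n) in hz2.
have p1 := @expV2_le1 R n.
have dbl := A2_doubling (a := t - h / 2) (b := t + h / 2)
  (a' := t - 2^-1 ^+ n) (b' := t + 2^-1 ^+ n) hK
  ltac:(lra) ltac:(lra) ltac:(lra) ltac:(lra).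
rewrite -/Wn in dbl.
set V := W (t - h / 2) (t + h / 2) in dbl *.
have Wn0 : 0 < Wn by apply: A2_pair_gt0 hK _; lra.
have V0 : 0 < V by apply: A2_pair_gt0 hK _; lra.
(* The arc of half-width [2^-n] has length at most [4 * h]: doubling by a ratio 4. *)
have dbl' : Wn <= 16 * K * V.
  rewrite -(ler_pM2r (_ : 0 < h ^+ 2)); last by rewrite exprn_gt0.
  move: dbl; rewrite (_ : t + h / 2 - (t - h / 2) = h); last lra.
  move=> /le_trans; apply.
  rewrite (_ : t + _ - _ = 2 * 2^-1 ^+ n); last lra.
  have : (2 * 2^-1 ^+ n) ^+ 2 <= (4 * h) ^+ 2 by rewrite ler_sqr ?nnegrE; lra.
  have KV : 0 <= K * V by rewrite mulr_ge0 ?(ltW V0)//; lra.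
  by move=> /(ler_wpM2l KV); rewrite exprMn [_ ^+ 2 in X in _ <= X]exprMn; lra.
(* This cancels the [4^n] of the tail estimate against the factor [h] of the kernel and that of
   [pext_A2_le]. *)
have h4 : 4 ^+ n * h ^+ 2 <= 1.
  rewrite -[leRHS](sqr_expV2 R n) ler_wpM2l ?exprn_ge0// ler_sqr ?nnegrE//; lra.
have e1 : 5 * h * (C * pext mu z) <= 5 * h * (C * ((16 * 16) * h * (G * (4 ^+ n * Wn)))).
  by rewrite ler_wpM2l ?ler_wpM2l//; lra.
apply: le_trans e1 _.
have -> : 5 * h * (C * ((16 * 16) * h * (G * (4 ^+ n * Wn)))) =
  ((5 * (16 * 16)) * C * G) * Wn * (4 ^+ n * h ^+ 2) by ring.
have CG : 0 <= (5 * (16 * 16)) * C * G by apply: mulr_ge0 G0; apply: mulr_ge0 C0; lra.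
have : (5 * (16 * 16)) * C * G * Wn * (4 ^+ n * h ^+ 2) <= (5 * (16 * 16)) * C * G * Wn * 1.
  by rewrite ler_wpM2l// mulr_ge0// ltW.
have := ler_wpM2l CG dbl'; lra.
Qed.

(* Finitely many sectors of height 1 cover the disc. *)
Lemma disc_mass_le D t : sector_carleson D ->
  (\int[tau]_(w in disc) (Lam w)%:E <= (4 * D * W (t - pi) (t + pi))%:E)%E.
Proof.
move=> [D0 hD]; have [hW _] := A2_density hmu.
have pi2 := @pi_ge2 R; have pi4 := @pi_lt4 R.
have iW := rmass_interval_function hW.
(* Centres -3, -1, 1, 3 with half-width 1 cover [[-4, 4]], hence all angles; at height 1 a sector
   reaches the origin. *)
pose S l : set (R * R) := sector 1 (2 * l%:R - 3).
have := @integral_le_cover _ _ R tau disc Lam (@measurable_disc R) mLam Lam_ge0 disc 4 S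
  (@measurable_disc R) (@subset_refl _ _).
move=> /(_ _ _ _)/wrap[].
- by move=> l; exact: measurable_sector.
- by move=> l; exact: sector_disc.
- move=> z /discE r1; have /andP[a1 a2] := ang_itv z.
  have cover (x : R) : -4 <= x -> x <= 4 -> exists2 l : nat, (l < 4)%N & `|x - (2 * l%:R - 3)| <= 1.
    move=> x1 x2.
    have [?|?] := leP x (-2); first by exists 0%N => //; rewrite ler_norml; apply/andP; split; lra.
    have [?|?] := leP x 0; first by exists 1%N => //; rewrite ler_norml; apply/andP; split; lra.
    have [?|?] := leP x 2; first by exists 2%N => //; rewrite ler_norml; apply/andP; split; lra.
    by exists 3%N => //; rewrite ler_norml; apply/andP; split; lra.
  have [l l4 hl] := cover (ang z) ltac:(lra) ltac:(lra).
  exists l => //; exists (rad z), (ang z); split => //; last exact: polarE.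
  by rewrite subrr rad_ge0.
move=> /le_trans; apply.
apply: (@le_trans _ _ (\sum_(l < 4) (D * W (t - pi) (t + pi))%:E)%E).
  apply: lee_sum => l _; apply: le_trans (hD _ _ ltr01 (lexx _)) _.
  rewrite lee_fin ler_wpM2l//.
  set c := 2 * l%:R - 3; have := ifun_period (c - pi) iW; have := ifun_period (t - pi) iW.
  rewrite (_ : t - pi + 2 * pi = t + pi); last by ring.
  move=> -> <-; apply: ifun_mono => //; lra.
by rewrite sumEFin lee_fin big_const_ord /= !addr0; lra.
Qed.

Lemma sector_to_kernel D : sector_carleson D -> exists C, kernel_carleson C.
Proof.
move=> hD; have [D0 hDs] := hD; have [K hK] := A2_pairP hmu; have K1 := A2_pair_ge1 hK.
have [hW _] := A2_density hmu; have iW := rmass_interval_function hW.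
have [W0 _ _] := iW.
pose G := (1 + 16 * K) * (16 * K ^+ 2).
have G0 : 0 <= G by rewrite !mulr_ge0 ?sqr_ge0//; lra.
exists ((16 * 16) * (4 * D) * G * 32); split; first by apply: mulr_ge0 => //; apply: mulr_ge0 G0; lra.
move=> z zD; have r1 : rad z < 1 by apply/discE.
have r0 := rad_ge0 z.
have [n [n1 n2]] := @dyadic_level R (1 - rad z) ltac:(lra) ltac:(lra).
set t := ang z.
have p0 := @expV2_gt0 R.
have p1 := @expV2_le1 R.
(* Slot 0 is the whole disc, for the constant 1 of the kernel bound; slot [m + 1] is the sector of
   level [m]. *)
pose S l : set (R * R) := if l is m.+1 then sector (2^-1 ^+ m) t else disc.
pose c (l : nat) : R := (16 * 16) * (1 - rad z) * (if l is m.+1 then 4 ^+ m else 1).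
have c0 l : 0 <= c l.
  by case: l => [|m]; rewrite /c !mulr_ge0 ?exprn_ge0//; lra.
have mS l : measurable (S l).
  by case: l => [|m]; [exact: measurable_disc|exact: measurable_sector].
have SD l : S l `<=` disc.
  by case: l => [|m]; [exact: subset_refl|exact: sector_disc].
have := @integral_le_weighted_sum _ _ R tau disc Lam (@measurable_disc R) mLam Lam_ge0 disc
  (poisson z) n.+2 c S (@measurable_disc R) (@subset_refl _ _) (@measurable_poissonr z disc) _ c0 mS SD.
move=> /(_ _ _)/wrap[].
- by move=> w _; exact: poisson_ge0.
- move=> w wD; rewrite big_ord_recl /= indicE mem_set// mulr1 {1}/c /= mulr1.
  have rw1 : rad w < 1 by apply/discE.
  rewrite {1}(polarE z) {1}(polarE w) poisson_polar.
  apply: le_trans (@kernel_bound _ (rad z) (rad w) (cos (ang w - t)) n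
    (fun m => w \in sector (2^-1 ^+ m) t) r0 r1 (rad_ge0 _) (ltW rw1) (cos_le1 _) n2 _) _.
    move=> m /negP; rewrite inE => nS; exact: notin_sector.
  rewrite mulrDr mulr1 lerD2l mulr_sumr ler_sum// => m _.
  by rewrite /c /= indicE mulrA.
move=> /le_trans; apply.
have key : (\sum_(l < n.+2) (c l)%:E * \int[tau]_(w in S l) (Lam w)%:E <=
   ((16 * 16) * (1 - rad z) * ((4 * D) * (W (t - pi) (t + pi) +
     \sum_(m < n.+1) 4 ^+ m * W (t - 2^-1 ^+ m) (t + 2^-1 ^+ m))))%:E)%E.
  rewrite big_ord_recl /= (mulrDr (4 * D)) (mulrDr ((16 * 16) * _)) EFinD leeD//.
    by rewrite /c mulr1 [X in (_ <= X)%E]EFinM lee_wpmul2l ?disc_mass_le// lee_fin mulr_ge0//; lra.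
  rewrite !mulr_sumr -sumEFin; apply: lee_sum => m _.
  rewrite (_ : (16 * 16) * _ * _ = c (bump 0 m) * (4 * D * W (t - 2^-1 ^+ m) (t + 2^-1 ^+ m))); last first.
    by rewrite /c /=; ring.
  rewrite [X in (_ <= X)%E]EFinM lee_wpmul2l ?lee_fin//.
  apply: le_trans (hDs _ t (p0 m) (p1 m)) _; rewrite lee_fin.
  have := p0 m => pm.
  have w1 : W (t - 2^-1 ^+ m / 2) (t + 2^-1 ^+ m / 2) <= W (t - 2^-1 ^+ m) (t + 2^-1 ^+ m).
    by apply: ifun_mono => //; lra.
  have w2 := W0 (t - 2^-1 ^+ m) (t + 2^-1 ^+ m) ltac:(lra).
  have := ler_wpM2l D0 w1; have := mulr_ge0 D0 w2; lra.
apply: le_trans key _; rewrite lee_fin.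
have tl := A2_tail_period t n hK; rewrite -/G in tl.
have lo := pext_A2_ge t r0 r1 n1 n2; rewrite -polarE in lo.
set P := pext mu z in lo *; set Wn := W (t - 2^-1 ^+ n) (t + 2^-1 ^+ n) in lo tl.
(* [1 - |z| <= 2^-n] and [Wn <= 32 * 2^-n * P] bring [2^-n] twice, against [4^n]. *)
have h2 : (16 * 16) * (1 - rad z) * (4 * D * (W (t - pi) (t + pi) +
     \sum_(m < n.+1) 4 ^+ m * W (t - 2^-1 ^+ m) (t + 2^-1 ^+ m))) <=
   (16 * 16) * 2^-1 ^+ n * (4 * D * (G * (4 ^+ n * (32 * 2^-1 ^+ n * P)))).
  apply: ler_pM; [by rewrite mulr_ge0//; lra| | |].
  - rewrite !mulr_ge0// addr_ge0//; first by apply: W0; have := @pi_gt0 R; lra.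
    rewrite sumr_ge0// => m _; rewrite mulr_ge0 ?exprn_ge0//; apply: W0.
    by have := p0 m; lra.
  - by rewrite ler_wpM2l.
  - rewrite ler_wpM2l ?mulr_ge0//; apply: le_trans tl _.
    by rewrite ler_wpM2l// ler_wpM2l ?exprn_ge0.
apply: le_trans h2 _.
have -> : (16 * 16) * 2^-1 ^+ n * (4 * D * (G * (4 ^+ n * (32 * 2^-1 ^+ n * P)))) =
  (16 * 16) * (4 * D) * G * 32 * P * (4 ^+ n * (2^-1 ^+ n) ^+ 2) by ring.
by rewrite sqr_expV2 mulr1.
Qed.

End CarlesonConditions.

(** * Testing the embedding on arcs *)

Section StrongImpliesSector.
Variables (R : realType) (mu lam : R -> R) (tau : {measure set (R * R)%type -> \bar R}).
Hypotheses (hmu : A2 mu) (hlam : A2 lam).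

Local Notation W := (rmass (EFin \o mu)).
Local Notation Lam := (pext lam).
Local Notation disc := (@disc R).
Local Notation leb := (@lebesgue_measure R).

Definition strong_carleson (B : R) : Prop := forall fr fi : R -> R,
  measurable_fun setT fr -> measurable_fun setT fi ->
  periodic2pi fr -> periodic2pi fi ->
  (wL2norm2 mu fr fi < +oo)%E ->
  (\int[tau]_(z in disc) (((pext fr z) ^+ 2 + (pext fi z) ^+ 2) * pext lam z)%:E
    <= B%:E * wL2norm2 mu fr fi)%E.

(** Defined through the cosine, the indicator of an arc of half-width [h] is periodic by
    construction. *)
Definition arc_indic (h c t : R) : R := \1_[set t : R | cos h <= cos (t - c)] t.

Lemma arc_indicE h c t : arc_indic h c t = (cos h <= cos (t - c))%R%:R.
Proof. by rewrite /arc_indic indicE mem_setE. Qed.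

Lemma measurable_arc_indic h c : measurable_fun setT (arc_indic h c).
Proof.
apply: measurable_indic; apply: measurable_set_le => //.
apply: measurableT_comp; first exact: measurable_cos.
exact: measurable_funB.
Qed.

Lemma arc_indic_periodic h c : periodic2pi (arc_indic h c).
Proof.
move=> t; rewrite !arc_indicE (_ : t + 2 * pi - c = t - c + pi *+ 2) ?cosD2pi//.
by rewrite -mulr_natl; ring.
Qed.

Lemma arc_indic_eq1 h c t : 0 <= h -> h <= pi -> `|t - c| <= h -> arc_indic h c t = 1.
Proof.
move=> h0 hp th; rewrite arc_indicE.
have -> : cos (t - c) = cos `|t - c| by case: (ger0P (t - c)) => _; rewrite ?cosN.
by rewrite ler_cos.
Qed.

Lemma arc_indic_eq0 h c t : 0 <= h -> h < `|t - c| -> `|t - c| <= pi -> arc_indic h c t = 0.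
Proof.
move=> h0 th tp; rewrite arc_indicE.
have -> : cos (t - c) = cos `|t - c| by case: (ger0P (t - c)) => _; rewrite ?cosN.
by rewrite leNgt ltr_cos ?th// in_itv/=; apply/andP; split => //; lra.
Qed.

Lemma arc_indic_itv h c t : 0 <= arc_indic h c t <= 1.
Proof. by rewrite arc_indicE ler0n lern1 leq_b1. Qed.

Lemma arc_indic_density h c : periodic_density (EFin \o arc_indic h c).
Proof.
have pi0 := @pi_gt0 R.
split.
- by apply/measurable_EFinP; exact: measurable_arc_indic.
- by move=> t /=; rewrite lee_fin; have /andP[] := arc_indic_itv h c t.
- by move=> t /=; rewrite arc_indic_periodic.
- apply: (@le_lt_trans _ _ (imass (fun=> 1%E) (- pi) pi)).
    apply: ge0_le_integral => //.
    + by move=> t _; rewrite lee_fin; have /andP[] := arc_indic_itv h c t.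
    + by apply: measurable_funTS; apply/measurable_EFinP; exact: measurable_arc_indic.
    + by move=> t _; rewrite lee_fin; have /andP[] := arc_indic_itv h c t.
  by rewrite imass1 ?ltry//; lra.
Qed.

Lemma wL2norm2_arc_indic h c : 0 <= h -> h <= pi ->
  (wL2norm2 mu (arc_indic h c) (fun=> 0%R) <= (W (c - h) (c + h))%:E)%E.
Proof.
move=> h0 hp; have [hW _] := A2_density hmu; have [mW W0 pW fW] := hW.
have mu0 t : 0 <= mu t by have [_ ? _ _] := hmu.
have pi2 := @pi_ge2 R.
pose v t : \bar R := ((arc_indic h c t ^+ 2 + 0 ^+ 2) * mu t)%:E.
have v0 t : (0 <= v t)%E by rewrite lee_fin mulr_ge0// addr_ge0 ?sqr_ge0.
have vmu t : (v t <= (EFin \o mu) t)%E.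
  rewrite lee_fin -[leRHS]mul1r ler_wpM2r//; have /andP[a b] := arc_indic_itv h c t.
  by rewrite expr0n addr0 expr_le1.
have mv : measurable_fun setT v.
  apply/measurable_EFinP; apply: measurable_funM; last exact/measurable_EFinP.
  by apply: measurable_funD => //; apply: measurable_funX; exact: measurable_arc_indic.
have hv : periodic_density v.
  split => //.
    by move=> t; rewrite /v arc_indic_periodic; have [->] := pW t.
  apply: le_lt_trans fW; apply: ge0_le_integral => //; exact: measurable_funTS.
have i1 : (imass v (- pi) pi <= (W (c - h) (c + h))%:E)%E.
  rewrite (imass_period c hv) -rmassK//.
  have mr : measurable_fun setT ((EFin \o mu) \_ `[c - h, c + h]).
    by apply/(measurable_restrictT _ _).1 => //; exact: measurable_funTS.
  apply: (@le_trans _ _ (\int[leb]_(t in `[(c - pi)%R, (c + pi)%R])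
     ((EFin \o mu) \_ `[(c - h)%R, (c + h)%R]) t)%E).
    have pt (t : R) : c - pi <= t <= c + pi -> (v t <= ((EFin \o mu) \_ `[(c - h)%R, (c + h)%R]) t)%E.
      rewrite -ler_distl => tp; rewrite /patch mem_setE in_itv/= -ler_distl.
      case: ifPn => [_|]; first exact: vmu.
      rewrite -ltNge => ht; rewrite /v arc_indic_eq0//.
      by rewrite expr0n addr0 mul0r.
    by apply: ge0_le_integral => //; exact: measurable_funTS.
  rewrite -integral_mkcondr; apply: ge0_subset_integral => //.
    exact: measurableI.
  exact: measurable_funTS.
rewrite /wL2norm2 -[leRHS]mul1e.
apply: lee_pmul => //.
- by rewrite lee_fin invr_ge0; lra.
- by apply: integral_ge0 => t _; exact: v0.
- by rewrite lee_fin invf_le1; lra.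
Qed.

(** The test arc has half-width [2 * h], so for [z] in the sector it contains the arc of half-width
    [1 - |z|] about the angle of [z]. Then [1 <= 2 * pi * pext f z <= 8 * pext f z], and
    [64 = 8^2]. *)
Lemma strong_to_sector B : strong_carleson B -> exists D, sector_carleson mu lam tau D.
Proof.
move=> hB; have [K hK] := A2_pairP hmu; have K1 := A2_pair_ge1 hK.
have B0 : 0 <= `|B| by [].
exists (64 * `|B| * (16 * K)); split; first by rewrite !mulr_ge0//; lra.
move=> h c h0 h1; have pi2 := @pi_ge2 R; have pi4 := @pi_lt4 R.
have sD := sector_disc (t := c) h0 h1.
have mS : measurable (sector h c) by exact: measurable_sector.
have mD := @measurable_disc R.
set f := arc_indic (2 * h) c.
have hf : periodic_density (EFin \o f) by exact: arc_indic_density.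
have mf : measurable_fun setT f by exact: measurable_arc_indic.
have f0 t : 0 <= f t by have /andP[] := arc_indic_itv (2 * h) c t.
have nrm := @wL2norm2_arc_indic (2 * h) c ltac:(lra) ltac:(lra); rewrite -/f in nrm.
have fin : (wL2norm2 mu f (fun=> 0%R) < +oo)%E by apply: le_lt_trans nrm _; rewrite ltry.
have key := hB f (fun=> 0%R) mf (@measurable_cst _ _ _ _ _ _) (arc_indic_periodic _ _)
  (fun=> erefl) fin.
set Q : R * R -> R := fun z => (pext f z ^+ 2 + pext (fun=> 0%R) z ^+ 2) * Lam z.
have mQ : measurable_fun disc Q.
  apply: measurable_funM; last exact: mLam.
  by apply: measurable_funD; apply: measurable_funX; apply: measurable_pext.
have Q0 z : disc z -> 0 <= Q z.
  by move=> zD; rewrite mulr_ge0 ?Lam_ge0// addr_ge0 ?sqr_ge0.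
have low z : sector h c z -> 1 <= 8 * pext f z.
  move=> [r [x [r1 r2 xc ->]]].
  have r0 : 0 <= r by lra.
  have := pext_ge x hf r0 r2 (lexx _) (_ : 1 - r <= pi) => /(_ ltac:(lra)).
  set H := 1 - r; have H0 : 0 < H by rewrite /H; lra.
  have -> : rmass (EFin \o f) (x - H) (x + H) = 2 * H.
    rewrite /rmass (_ : imass _ _ _ = imass (fun=> 1%E) (x - H) (x + H)).
      by rewrite imass1/=; lra.
    apply: eq_integral => t; rewrite mem_setE in_itv/= -ler_distl => tx /=.
    congr EFin; apply: arc_indic_eq1; [lra|lra|].
    by move: tx xc; rewrite /H !ler_norml => /andP[? ?] /andP[? ?]; apply/andP; split; lra.
  have -> : H / (2 * H ^+ 2) * (2 * H) = 1 by field; rewrite gt_eqF.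
  set P := pext _ _ => h2.
  have P0 : 0 <= P by apply: pext_ge0 => //; exact: disc_polar.
  have := ler_wpM2r P0 (ltW pi4); lra.
have step : (\int[tau]_(w in sector h c) (Lam w)%:E <=
    64%:E * \int[tau]_(w in disc) (Q w)%:E)%E.
  rewrite -ge0_integralZl_EFin//; last exact/measurable_EFinP.
  have mk : measurable_fun disc (fun w => 64%:E * (Q w)%:E)%E.
    by apply: measurable_funeM; exact/measurable_EFinP.
  have k0 w : disc w -> (0 <= 64%:E * (Q w)%:E)%E.
    by move=> wD; rewrite -EFinM lee_fin; apply: mulr_ge0 => //; exact: Q0.
  apply: (@le_trans _ _ (\int[tau]_(w in sector h c) (64%:E * (Q w)%:E))%E);
    last exact: ge0_subset_integral.
  apply: ge0_le_integral => //.
  - by move=> w /sD wD; rewrite lee_fin Lam_ge0.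
  - by apply/measurable_EFinP; apply: measurable_funS (mLam hlam).
  - exact: measurable_funS mk.
  move=> w wS; have wD := sD _ wS; have lw := low _ wS.
  rewrite -EFinM lee_fin /Q mulrA -[leLHS]mul1r ler_wpM2r ?Lam_ge0//.
  have := sqr_ge0 (pext (fun=> 0%R) w); nra.
apply: le_trans step _.
have B1 : (B%:E * wL2norm2 mu f (fun=> 0%R) <= (`|B| * W (c - 2 * h) (c + 2 * h))%:E)%E.
  rewrite EFinM.
  apply: (@le_trans _ _ (`|B|%:E * wL2norm2 mu f (fun=> 0%R))%E).
    apply: lee_wpmul2r; last by rewrite lee_fin ler_norm.
    rewrite mule_ge0 ?lee_fin ?invr_ge0; [by []|lra|].
    apply: integral_ge0 => t _; rewrite lee_fin mulr_ge0 ?addr_ge0 ?sqr_ge0//.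
    by have [_ ? _ _] := hmu.
  by rewrite lee_wpmul2l ?lee_fin.
apply: (@le_trans _ _ (64%:E * (`|B| * W (c - 2 * h) (c + 2 * h))%:E)%E).
  by apply: lee_wpmul2l; [rewrite lee_fin|apply: le_trans key B1].
rewrite -EFinM lee_fin.
have d := A2_doubling (a := c - h / 2) (b := c + h / 2)
  (a' := c - 2 * h) (b' := c + 2 * h) hK ltac:(lra) ltac:(lra) ltac:(lra) ltac:(lra).
set V := W (c - h / 2) (c + h / 2) in d *; set U := W _ _ in d *.
have d' : U <= 16 * K * V.
  rewrite -(ler_pM2r (_ : 0 < h ^+ 2)); last by rewrite exprn_gt0.
  move: d; rewrite (_ : c + h / 2 - (c - h / 2) = h); last lra.
  move=> /le_trans; apply.
  by rewrite (_ : c + 2 * h - _ = 4 * h); [rewrite exprMn; lra|lra].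
have := ler_wpM2l (_ : 0 <= 64 * `|B|) d'; rewrite mulr_ge0// => /(_ isT); lra.
Qed.

End StrongImpliesSector.

(** * Dyadic arcs and the weights attached to a point *)

Section DyadicArcs.
Variable R : realType.
Implicit Types (V : R -> R -> R) (z : R * R) (m j i : nat).
Local Notation pi := (@pi R).

(* Level-[m] arcs have length [2 pi / 2^m]. The four roots [j < 4] of level 0 cover
   [[-3 pi, 5 pi]], so that neighbours of arcs meeting [[-pi, pi]] never wrap around. *)
Definition dyad m j : R := 2 * pi * (j%:R * 2^-1 ^+ m) - 3 * pi.

Lemma dyadS m j : dyad m j.+1 = dyad m j + 2 * pi * 2^-1 ^+ m.
Proof. by rewrite /dyad -[j.+1%:R]natr1; ring. Qed.

Lemma dyad_double m j : dyad m.+1 j.*2 = dyad m j.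
Proof. by rewrite /dyad -muln2 natrM exprSr; field. Qed.

Definition itree V m j : R := V (dyad m j) (dyad m j.+1).

Lemma itree_additive V : interval_function V -> tree_additive (itree V).
Proof.
move=> [_ VD _] m j; have pi0 := @pi_gt0 R; have e := expV2_gt0 R m.+1.
have p := mulr_gt0 pi0 e.
rewrite /itree -doubleS !dyad_double; apply: VD; rewrite -1?(dyad_double m j) -?(dyad_double m j.+1) ?doubleS !dyadS; lra.
Qed.

(** Position of the angle in units of level-[m] arcs. It ranges over [[2^m, 2 * 2^m]], so the arc
    [idx m z] always has a left neighbour. *)
Definition dyad_coord m z : R := (ang z + 3 * pi) / (2 * pi) * 2 ^+ m.
Definition idx m z : nat := Num.truncn (dyad_coord m z).

Lemma dyad_coord_itv m z : 2 ^+ m <= dyad_coord m z <= 2 * 2 ^+ m.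
Proof.
have /andP[a1 a2] := ang_itv z; have pi0 := @pi_gt0 R.
have p0 : 0 < 2 ^+ m :> R by rewrite exprn_gt0.
rewrite /dyad_coord -{1}[2 ^+ m]mul1r !ler_pM2r// ler_pdivlMr ?ler_pdivrMr; [|lra|lra].
by apply/andP; split; lra.
Qed.

Lemma idx_itv m z : dyad m (idx m z) <= ang z <= dyad m (idx m z).+1.
Proof.
have pi0 := @pi_gt0 R; have p0 : 0 < 2 ^+ m :> R by rewrite exprn_gt0.
have /andP[c1 c2] := dyad_coord_itv m z.
have c0 : 0 <= dyad_coord m z by apply: le_trans c1; exact: ltW.
have /andP[t1 t2] := truncn_itv c0; rewrite -/(idx m z) in t1 t2.
have e : ang z = 2 * pi * (dyad_coord m z * 2^-1 ^+ m) - 3 * pi.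
  by rewrite /dyad_coord -[_ * 2 ^+ m * _]mulrA expV2M mulr1 mulrC divfK ?addrK// gt_eqF; lra.
have q := expV2_gt0 R m; rewrite {1 2}e /dyad !lerD2r !ler_pM2l; [|lra..].
by rewrite !ler_pM2r// t1 ltW.
Qed.

Lemma idx_gt0 m z : (0 < idx m z)%N.
Proof.
rewrite truncn_gt0; have /andP[c1 _] := dyad_coord_itv m z.
by apply: le_trans c1; rewrite exprn_ege1//; lra.
Qed.

Lemma idx_le m z : (idx m z <= 2 * 2 ^ m)%N.
Proof.
have /andP[c1 c2] := dyad_coord_itv m z; rewrite -(ler_nat R) natrM natrX.
by apply: le_trans c2; rewrite truncn_le; apply: le_trans c1; rewrite exprn_ge0.
Qed.

Lemma measurable_idx_eq m i j : measurable [set z | (idx m z + i == j.+1)%N].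
Proof.
have mc : measurable_fun setT (dyad_coord m).
  apply: measurable_funM => //; apply: measurable_funM => //.
  by apply: measurable_funD => //; exact: measurable_ang.
have [ij|ij] := leqP i j.+1; last first.
  rewrite (_ : [set z | _] = set0)//; apply/seteqP; split => // z /= /eqP; lia.
rewrite (_ : [set z | _] = [set z | (j.+1 - i)%:R <= dyad_coord m z] `&`
   [set z | dyad_coord m z < (j.+1 - i).+1%:R]).
  by apply: measurableI; [exact: measurable_set_le|exact: measurable_set_lt].
have H z : (idx m z + i == j.+1)%N = ((j.+1 - i)%:R <= dyad_coord m z < (j.+1 - i).+1%:R).
  rewrite -truncn_eq; last first.
    by have /andP[c1 _] := dyad_coord_itv m z; apply: le_trans c1; rewrite exprn_ge0.
  by rewrite -/(idx m z); apply/eqP/eqP; lia.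
by apply/seteqP; split => z /=; rewrite H; [move=> /andP|move=> [-> ->]].
Qed.

(** The share of scale [m] in the kernel at [z]: cut off at scales finer than [1 - |z|] and decaying
    geometrically towards coarse ones. *)
Definition height m z : R :=
  (1 - rad z <= 2^-1 ^+ m)%R%:R * (2 ^+ m * (1 - rad z)).

Lemma height_ge0 m z : disc z -> 0 <= height m z.
Proof.
by move=> /discE r1; rewrite /height !mulr_ge0 ?exprn_ge0//; lra.
Qed.

Lemma height_le1 m z : disc z -> height m z <= 1.
Proof.
move=> /discE r1; rewrite /height; case: (leP (1 - rad z) (2^-1 ^+ m)) => h /=; last by rewrite mul0r ler01.
rewrite mul1r.
by rewrite -[leRHS](expV2M R m) ler_pM2l// exprn_gt0.
Qed.

(** The induction also carries the bound [2^(M + N) * (1 - |z|)], which equals the next height as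
    long as scales are active; as heights are at most 1, the total stays below 2. *)
Lemma sum_height M N z : disc z -> \sum_(d < N) height (M + d) z <= 2.
Proof.
move=> zD; have r1 : rad z < 1 by apply/discE.
suff [] : \sum_(d < N) height (M + d) z <= 2 /\
    \sum_(d < N) height (M + d) z <= 2 ^+ (M + N) * (1 - rad z) by [].
elim: N => [|N [IH1 IH2]].
  by rewrite big_ord0; split => //; rewrite mulr_ge0 ?exprn_ge0//; lra.
rewrite big_ord_recr /= addnS exprS.
have p0 : 0 <= 2 ^+ (M + N) * (1 - rad z) by rewrite mulr_ge0 ?exprn_ge0//; lra.
rewrite {2 4}/height; case: (leP (1 - rad z) (2^-1 ^+ (M + N))) => h /=; last by rewrite mul0r addr0; split; lra.
rewrite mul1r.
have := height_le1 (M + N) zD; rewrite /height h mul1r => h1.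
by split; lra.
Qed.

Lemma measurable_height m : measurable_fun setT (height m).
Proof.
have mr := @measurable_rad R.
have mb : measurable [set z : R * R | 1 - rad z <= 2^-1 ^+ m].
  by apply: measurable_set_le => //; exact: measurable_funB.
rewrite /height (_ : (fun z => _) = (fun z => \1_[set z : R * R | 1 - rad z <= 2^-1 ^+ m] z *
  (2 ^+ m * (1 - rad z)))); last by apply/funext => z; rewrite indicE mem_setE.
apply: measurable_funM; first exact: measurable_indic.
by apply: measurable_funM => //; exact: measurable_funB.
Qed.

(** For [i = 0, 1, 2] the arc [j] is the left neighbour of the arc of [z], that arc itself, or its
    right neighbour; [j.+1] avoids a subtraction in [nat]. *)
Definition wgt i m j z : R := height m z * (idx m z + i == j.+1)%N%:R.

Lemma wgt_ge0 i m j z : disc z -> 0 <= wgt i m j z.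
Proof. by move=> zD; rewrite mulr_ge0// height_ge0. Qed.

Lemma wgt_le1 i m j z : disc z -> wgt i m j z <= 1.
Proof.
move=> zD; rewrite -[leRHS]mulr1 ler_pM ?height_ge0 ?height_le1//.
by rewrite lern1 leq_b1.
Qed.

Lemma measurable_wgt i m j D : measurable_fun D (wgt i m j).
Proof.
apply: measurable_funTS; rewrite /wgt (_ : (fun z => _) =
  (fun z => height m z * \1_[set z | (idx m z + i == j.+1)%N] z)); last first.
  by apply/funext => z; rewrite indicE mem_setE.
apply: measurable_funM; first exact: measurable_height.
by apply: measurable_indic; exact: measurable_idx_eq.
Qed.

Lemma sum_idx_le1 i m a n z : (\sum_(k < n) (idx m z + i == (a + k).+1) <= 1)%N.
Proof.
have [|/forallPn /= [k0]] := boolP [forall k : 'I_n, (idx m z + i != (a + k).+1)%N].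
  by move=> /forallP h; rewrite big1// => k _; rewrite (negbTE (h k)).
rewrite negbK => /eqP h; rewrite (bigD1 k0)//= h eqxx big1// => k kk0.
by case: eqP => // /eqP; rewrite eqSS eqn_add2l => /eqP e; case/eqP: kk0; exact/val_inj.
Qed.

(** The pointwise Carleson property: each generation selects at most one arc, heights sum to at most
    2, and a selected descendant forces [z] into the box over the arc enlarged by its own length on
    both sides. *)
Lemma tsum_wgt_le i N M J z : (i < 3)%N -> disc z ->
  tsum (fun m j => wgt i m j z) N M J <= 2 *
  \1_[set z | disc z /\ [/\ 1 - rad z <= 2^-1 ^+ M,
       dyad M J - 2 * pi * 2^-1 ^+ M <= ang z &
       ang z <= dyad M J.+1 + 2 * pi * 2^-1 ^+ M]] z.
Proof.
move=> i3 zD; rewrite tsumE indicE; have pi0 := @pi_gt0 R.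
have r1 : rad z < 1 by apply/discE.
have hs d : \sum_(k < 2 ^ d) wgt i (M + d) (2 ^ d * J + k) z =
   height (M + d) z * (\sum_(k < 2 ^ d) (idx (M + d) z + i == (2 ^ d * J + k).+1))%N%:R.
  by rewrite /wgt -mulr_sumr natr_sum.
have le1 : \sum_(d < N) \sum_(k < 2 ^ d) wgt i (M + d) (2 ^ d * J + k) z <= 2.
  apply: le_trans (sum_height M N zD); apply: ler_sum => d _.
  rewrite hs ler_piMr ?height_ge0// lern1; exact: sum_idx_le1.
case: (boolP (z \in _)) => [_|]; first by rewrite mulr1.
rewrite notin_setE /= => nz; rewrite mulr0 le_eqVlt; apply/orP; left; apply/eqP.
apply: big1 => d _; apply: big1 => k _.
rewrite /wgt; case: eqP => [h|]; last by rewrite mulr0.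
rewrite /height; case: (leP (1 - rad z) (2^-1 ^+ (M + d))) => hh; last by rewrite !mul0r.
exfalso; apply: nz; split => //.
have /andP[a1 a2] := idx_itv (M + d) z.
have q := expV2_gt0 R (M + d); have qM := expV2_gt0 R M; have qd := expV2_gt0 R d.
have qle := expV2_le R (leq_addr d M).
have pq := ler_wpM2l (ltW pi0) qle.
have e : 2^-1 ^+ (M + d) * 2 ^+ d = 2^-1 ^+ M :> R.
  by rewrite exprD -mulrA [_ * 2 ^+ d]mulrC expV2M mulr1.
have hr : (idx (M + d) z)%:R + i%:R = 2 ^+ d * J%:R + k%:R + 1 :> R.
  by rewrite -natrD h -natr1 natrD natrM natrX.
have i2 : i%:R <= 2 :> R by rewrite ler_nat.
have i0 : 0 <= i%:R :> R by [].
have k0 : 0 <= (k : nat)%:R :> R by [].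
have kd : (k : nat)%:R + 1 <= 2 ^+ d :> R.
  by rewrite natr1 -natrX ler_nat.
rewrite dyadS in a2; rewrite dyadS.
have lo : J%:R * 2^-1 ^+ M - 2^-1 ^+ (M + d) <= (idx (M + d) z)%:R * 2^-1 ^+ (M + d) :> R.
  have -> : J%:R * 2^-1 ^+ M - 2^-1 ^+ (M + d) = (2 ^+ d * J%:R - 1) * 2^-1 ^+ (M + d) :> R.
    by rewrite -e; ring.
  by rewrite ler_pM2r//; lra.
have hi : (idx (M + d) z)%:R * 2^-1 ^+ (M + d) <= J%:R * 2^-1 ^+ M + 2^-1 ^+ M :> R.
  have -> : J%:R * 2^-1 ^+ M + 2^-1 ^+ M = (2 ^+ d * J%:R + 2 ^+ d) * 2^-1 ^+ (M + d) :> R.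
    by rewrite -e; ring.
  by rewrite ler_pM2r//; lra.
have lo' := ler_wpM2l (ltW pi0) lo; have hi' := ler_wpM2l (ltW pi0) hi.
rewrite /dyad in a1 a2 *; rewrite mulrBr in lo'; rewrite mulrDr in hi'.
by split; lra.
Qed.

End DyadicArcs.

(** * The squared extension as a tree sum *)

Section PointwiseBound.
Variable R : realType.
Local Notation pi := (@pi R).

(** Expanding the weighted sum of [(a m - S / 2)^2], with total weight at most 2, leaves
    [Q - S^2 / 2 >= 0]. *)
Lemma sqr_weighted_sum_le n (e a : nat -> R) : (forall m, 0 <= e m) ->
  \sum_(m < n) e m <= 2 ->
  (\sum_(m < n) e m * a m) ^+ 2 <= 2 * \sum_(m < n) e m * a m ^+ 2.
Proof.
move=> e0 e2; set S := \sum_(m < n) e m * a m; set Q := \sum_(m < n) e m * a m ^+ 2.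
have : 0 <= \sum_(m < n) e m * (a m - S / 2) ^+ 2.
  by apply: sumr_ge0 => m _; rewrite mulr_ge0// sqr_ge0.
rewrite (eq_bigr (fun m : 'I_n => e m * a m ^+ 2 - S * (e m * a m) + S ^+ 2 / 4 * e m)); last first.
  by move=> m _; field.
rewrite big_split sumrB /= -!mulr_sumr -/S -/Q => h.
have := ler_wpM2l (sqr_ge0 S) e2; rewrite expr2 in h *; nra.
Qed.

Lemma neighbour_index_lt (a b c : nat) :
  (0 < b)%N -> (a.+1 <= 2 * b)%N -> (c < 3)%N -> (a + c < 4 * b)%N.
Proof. lia. Qed.

Lemma ler_double_sum_term (n k x y : nat) (F : nat -> nat -> R) :
  (x < n)%N -> (y < k)%N -> (forall i j, 0 <= F i j) ->
  F x y <= \sum_(i < n) \sum_(j < k) F i j.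
Proof.
move=> xn yk F0; rewrite (bigD1 (Ordinal xn))//= (bigD1 (Ordinal yk))//= -addrA lerDl.
by rewrite addr_ge0 ?sumr_ge0// => i _; rewrite sumr_ge0.
Qed.

(** Blocks [T m] of three dyadic arcs replace the centred arcs. Since [T 0] also absorbs the full
    period, [16 * 16] doubles to [32 * 16]. In [6 * 64], 2 comes from Cauchy-Schwarz over scales, 3
    from that over the three arcs, and [64 >= (2 * pi)^2]. *)
Lemma pext_sqr_le (g : R -> R) z N : periodic_density (EFin \o g) -> disc z ->
  2^-1 ^+ N <= 2 * (1 - rad z) ->
  pext g z ^+ 2 <= (32 * 16) ^+ 2 * (6 * 64) *
    \sum_(i < 3) \sum_(J < 4)
      tsum (fun m j => wgt i m j z *
         (itree (rmass (EFin \o g)) m j / (2 * pi * 2^-1 ^+ m)) ^+ 2) N.+2 0 J.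
Proof.
move=> hg zD hN; have r1 : rad z < 1 by apply/discE.
have r0 := rad_ge0 z; have pi2 := @pi_ge2 R; have pi4 := @pi_lt4 R.
have [n [n1 n2]] := @dyadic_level R (1 - rad z) ltac:(lra) ltac:(lra).
(* Otherwise [2^-n <= 2^-N / 4 <= (1 - |z|) / 2]. *)
have nN : (n < N.+2)%N.
  rewrite ltnNge; apply/negP => Nn; have := expV2_le R Nn; rewrite !exprS.
  have := @expV2_gt0 R N; lra.
set X := rmass (EFin \o g); have iX : interval_function X := rmass_interval_function hg.
have [X0 XD _] := iX.
pose k m := (idx m z).-1.
have kE m : idx m z = (k m).+1 by rewrite prednK// idx_gt0.
pose T m := X (dyad R m (k m)) (dyad R m (k m + 3)).
have len m : 0 < pi * 2^-1 ^+ m by rewrite mulr_gt0 ?expV2_gt0//; lra.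
have k3 m : (k m + 3 = (k m).+3)%N by rewrite addnC.
have TE m : T m = \sum_(i < 3) itree X m (k m + i).
  rewrite !big_ord_recr big_ord0 /= add0r /itree addn0 addn1 addn2 /T k3.
  rewrite (XD (dyad R m (k m)) (dyad R m (k m).+2)); last 2 first.
  - by rewrite !dyadS; have := len m; lra.
  - by rewrite !dyadS; have := len m; lra.
  rewrite (XD (dyad R m (k m)) (dyad R m (k m).+1))//.
  - by rewrite !dyadS; have := len m; lra.
  - by rewrite !dyadS; have := len m; lra.
have angk m : dyad R m (k m).+1 <= ang z <= dyad R m (k m).+2.
  by have := idx_itv m z; rewrite kE.
have T1 m : X (ang z - 2^-1 ^+ m) (ang z + 2^-1 ^+ m) <= T m.
  have /andP[a1 a2] := angk m; have q := @expV2_gt0 R m.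
  have : 2 * 2^-1 ^+ m <= pi * 2^-1 ^+ m by rewrite ler_wpM2r// ltW.
  move=> h; rewrite /T k3; rewrite !dyadS in a1 a2 *.
  by apply: ifun_mono => //; lra.
have T2 : X (ang z - pi) (ang z + pi) <= T 0%N.
  have /andP[a1 a2] := angk 0%N.
  rewrite /T k3; rewrite !dyadS !expr0 !mulr1 in a1 a2 *.
  by apply: ifun_mono => //; lra.
have T0 m : 0 <= T m.
  by rewrite /T k3 !dyadS; apply: X0; have := len m; lra.
have f0 m : 0 <= 4 ^+ m :> R by rewrite exprn_ge0.
have Sn : T 0%N <= \sum_(m < n.+1) 4 ^+ m * T m.
  by rewrite big_ord_recl /= expr0 mul1r lerDl sumr_ge0// => m _; rewrite mulr_ge0.
have P0 : 0 <= pext g z by exact: pext_ge0.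
have b1 : pext g z <= 32 * 16 * \sum_(m < n.+1) height m z * (2 ^+ m * T m).
  have := pext_le (ang z) hg r0 r1 n2; rewrite -polarE => /le_trans; apply.
  have -> : 32 * 16 * \sum_(m < n.+1) height m z * (2 ^+ m * T m) =
     16 * 16 * (1 - rad z) * (2 * \sum_(m < n.+1) 4 ^+ m * T m).
    rewrite !mulr_sumr; apply: eq_bigr => m _.
    have -> : height m z = 2 ^+ m * (1 - rad z).
      rewrite /height (le_trans n1) ?mul1r//; apply: expV2_le; exact: leq_ord.
    have -> : 4 ^+ m = 2 ^+ m * 2 ^+ m :> R by rewrite -exprMn; congr (_ ^+ _); ring.
    ring.
  rewrite ler_wpM2l ?mulr_ge0//; first by lra.
  rewrite mulr_natl mulr2n lerD ?(le_trans T2)//.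
  by apply: ler_sum => m _; rewrite ler_wpM2l.
have e0 m : 0 <= height m z by exact: height_ge0.
have sq := @sqr_weighted_sum_le n.+1 (fun m => height m z) (fun m => 2 ^+ m * T m) e0
  (sum_height 0 n.+1 zD).
set A := \sum_(m < n.+1) height m z * (2 ^+ m * T m) in b1 sq.
set Q := \sum_(m < n.+1) _ in sq.
have b2 : pext g z ^+ 2 <= (32 * 16) ^+ 2 * (2 * Q).
  apply: (@le_trans _ _ ((32 * 16 * A) ^+ 2)).
    by rewrite ler_sqr ?nnegrE// (le_trans P0).
  by rewrite exprMn ler_wpM2l// sqr_ge0.
apply: le_trans b2 _; rewrite -[leRHS]mulrA; apply: ler_wpM2l; first exact: sqr_ge0.
pose q m j := (itree X m j / (2 * pi * 2^-1 ^+ m)) ^+ 2.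
have Q1 : Q <= 3 * 64 * \sum_(i < 3) \sum_(m < n.+1) height m z * q m (k m + i)%N.
  rewrite exchange_big mulr_sumr; apply: ler_sum => m _ /=.
  rewrite -mulr_sumr [leRHS]mulrCA; apply: ler_wpM2l => //.
  have tq j : itree X m j ^+ 2 * 4 ^+ m <= 64 * q m j.
    have -> : q m j = itree X m j ^+ 2 * 4 ^+ m / (2 * pi) ^+ 2.
      rewrite /q expr_div_n exprMn; have e4 := sqr_expV2 R m.
      have -> : (2^-1 ^+ m) ^+ 2 = (4 ^+ m)^-1 :> R.
        by apply: (mulfI (_ : 4 ^+ m != 0)); rewrite ?expf_neq0// e4 divff// expf_neq0.
      by rewrite invfM invrK mulrA mulrAC.
    set t := itree X m j ^+ 2 * 4 ^+ m.
    have t0 : 0 <= t by rewrite mulr_ge0 ?sqr_ge0.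
    rewrite mulrA ler_pdivlMr ?exprn_gt0//; last by lra.
    rewrite [64 * t]mulrC; apply: ler_wpM2l => //.
    by rewrite expr2; nra.
  rewrite exprMn TE.
  have cs : (\sum_(i < 3) itree X m (k m + i)) ^+ 2 <= 3 * \sum_(i < 3) itree X m (k m + i) ^+ 2.
    rewrite !big_ord_recr !big_ord0 /= !add0r.
    set a := itree _ _ _; set b := itree _ _ _; set c := itree _ _ _.
    have := sqr_ge0 (a - b); have := sqr_ge0 (b - c); have := sqr_ge0 (a - c); nra.
  have -> : (2 ^+ m) ^+ 2 = 4 ^+ m :> R.
    by rewrite -exprM mulnC exprM; congr (_ ^+ _); ring.
  apply: le_trans (ler_wpM2l (f0 m) cs) _.
  rewrite mulrCA -[leRHS]mulrA; apply: ler_wpM2l => //.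
  rewrite !mulr_sumr; apply: ler_sum => i _; rewrite mulrC; exact: tq.
apply: (@le_trans _ _ (2 * (3 * 64 * \sum_(i < 3) \sum_(m < n.+1) height m z * q m (k m + i)%N))).
  by rewrite ler_wpM2l.
rewrite !mulrA (_ : 2 * 3 * 64 = 6 * 64 :> R); last by ring.
apply: ler_wpM2l => //; apply: ler_sum => i _.
under [leRHS]eq_bigr do rewrite tsumE.
rewrite exchange_big /= (big_ord_widen N.+2 (fun m => height m z * q m (k m + i)%N))//.
rewrite big_mkcond /=; apply: ler_sum => d _.
have w0 m j : 0 <= wgt i m j z * q m j by rewrite mulr_ge0 ?wgt_ge0 ?sqr_ge0.
case: ifP => _; last by apply: sumr_ge0 => J _; apply: sumr_ge0 => k' _; exact: w0.
(* Arc [j] of level [d] descends from the root [j %/ 2 ^ d], in position [j %% 2 ^ d]. *)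
set j := (k d + i)%N.
have j4 : (j %/ 2 ^ d < 4)%N.
  rewrite ltn_divLR ?expn_gt0//; apply: neighbour_index_lt (ltn_ord i); first by rewrite expn_gt0.
  by rewrite -kE; exact: idx_le.
have jm : (j %% 2 ^ d < 2 ^ d)%N by rewrite ltn_mod expn_gt0.
have -> : height d z * q d j =
    wgt i (0 + d) (2 ^ d * (j %/ 2 ^ d) + j %% 2 ^ d) z *
    q (0 + d)%N (2 ^ d * (j %/ 2 ^ d) + j %% 2 ^ d)%N.
  by rewrite mulnC -divn_eq add0n /wgt kE addSn eqxx mulr1.
by apply: (ler_double_sum_term (F := fun J k' => wgt i (0 + d) (2 ^ d * J + k') z *
    q (0 + d)%N (2 ^ d * J + k')%N) j4 jm) => ? ?; exact: w0.
Qed.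

End PointwiseBound.

(** * Integrals of tree sums *)

Section TreeIntegrals.
Context d (T : measurableType d) (R : realType).
Variables (nu : {measure set T -> \bar R}) (D : set T) (f : T -> R).
Hypotheses (mD : measurable D) (mf : measurable_fun D f).
Hypothesis f0 : forall x, D x -> 0 <= f x.
Variables (w : nat -> nat -> T -> R) (a : nat -> nat -> R).
Hypothesis mw : forall m j, measurable_fun D (w m j).
Hypothesis w0 : forall m j x, D x -> 0 <= w m j x.
Hypothesis wa : forall m j, (\int[nu]_(x in D) (w m j x * f x)%:E = (a m j)%:E)%E.

Lemma tsum_ge0_at N m j x : D x -> 0 <= tsum (fun m j => w m j x) N m j.
Proof. by move=> Dx; apply: tsum_ge0 => m' j'; exact: w0. Qed.

Lemma measurable_tsum N m j : measurable_fun D (fun x => tsum (fun m j => w m j x) N m j).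
Proof.
elim: N m j => [|N IH] m j /=; first exact: measurable_cst.
by apply: measurable_funD => //; exact: measurable_funD.
Qed.

Lemma tsum_integral N m j :
  (\int[nu]_(x in D) (tsum (fun m j => w m j x) N m j * f x)%:E = (tsum a N m j)%:E)%E.
Proof.
elim: N m j => [|N IH] m j /=.
  by under eq_integral do rewrite mul0r; rewrite integral0.
have mt m' j' : measurable_fun D (fun x => (tsum (fun m j => w m j x) N m' j' * f x)%:E).
  by apply/measurable_EFinP; apply: measurable_funM => //; exact: measurable_tsum.
have t0 m' j' x : D x -> (0 <= (tsum (fun m j => w m j x) N m' j' * f x)%:E)%E.
  by move=> Dx; rewrite lee_fin mulr_ge0 ?f0// tsum_ge0_at.
under eq_integral do rewrite !mulrDl !EFinD.
rewrite ge0_integralD//; last 4 first.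
- by move=> x Dx; rewrite lee_fin mulr_ge0 ?f0 ?w0.
- by apply/measurable_EFinP; exact: measurable_funM.
- by move=> x Dx; rewrite adde_ge0 ?t0.
- by apply: emeasurable_funD; exact: mt.
rewrite ge0_integralD//; [|exact: t0..].
by rewrite wa !IH.
Qed.

End TreeIntegrals.

(** * From sectors to the embedding *)

Section SectorImpliesStrong.
Variables (R : realType) (mu lam : R -> R) (tau : {measure set (R * R)%type -> \bar R}).
Hypotheses (hmu : A2 mu) (hlam : A2 lam).
Variable D : R.
Hypothesis hD : sector_carleson mu lam tau D.

Local Notation W := (rmass (EFin \o mu)).
Local Notation Lam := (pext lam).
Local Notation disc := (@disc R).
Local Notation pi := (@pi R).

(** A real number, because the Bellman argument subtracts; finiteness comes from the mass of the
    whole disc. *)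
Definition wmass i m j : R := fine (\int[tau]_(z in disc) (wgt i m j z * Lam z)%:E).

Lemma wmassE i m j :
  (\int[tau]_(z in disc) (wgt i m j z * Lam z)%:E = (wmass i m j)%:E)%E.
Proof.
rewrite fineK// ge0_fin_numE; last first.
  by apply: integral_ge0 => z zD; rewrite lee_fin mulr_ge0 ?wgt_ge0 ?Lam_ge0.
apply: (@le_lt_trans _ _ (\int[tau]_(z in disc) (Lam z)%:E)%E); last first.
  by apply: le_lt_trans (disc_mass_le hmu hlam 0 hD) _; rewrite ltry.
apply: ge0_le_integral => //.
- exact: measurable_disc.
- by move=> z zD; rewrite lee_fin mulr_ge0 ?wgt_ge0 ?Lam_ge0.
- apply/measurable_EFinP; apply: measurable_funM; [exact: measurable_wgt|exact: mLam].
- by apply/measurable_EFinP; exact: mLam.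
- by move=> z zD; rewrite lee_fin -[leRHS]mul1r ler_wpM2r ?Lam_ge0 ?wgt_le1.
Qed.

Lemma wmass_ge0 i m j : 0 <= wmass i m j.
Proof.
by rewrite fine_ge0// integral_ge0// => z zD; rewrite lee_fin mulr_ge0 ?wgt_ge0 ?Lam_ge0.
Qed.

(** The enlarged box over an arc of length [2 * pi * q] has angular width [6 * pi * q < 24 * q] and
    is covered by 12 sectors of height [q]; the weights sum to at most 2, whence 24. Doubling from
    length at least [4 * q] to [24 * q] gives [36 * K]. *)
Lemma wmass_carleson K i N M J : A2_pair K W (rmass (einv mu)) -> (i < 3)%N ->
  tsum (wmass i) N M J <= 24 * 36 * D * K * itree W M J.
Proof.
move=> hK i3; have K1 := A2_pair_ge1 hK; have [D0 hDs] := hD.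
have [hW _] := A2_density hmu; have iW := rmass_interval_function hW; have [W0 _ _] := iW.
have pi2 := @pi_ge2 R; have pi4 := @pi_lt4 R.
have q0 := @expV2_gt0 R M; have q1 := @expV2_le1 R M.
set q : R := 2^-1 ^+ M in q0 q1.
have pq2 : 2 * q <= pi * q by rewrite ler_wpM2r// ltW.
have pq4 : pi * q < 4 * q by rewrite ltr_pM2r.
pose a := dyad R M J - 2 * pi * q.
pose A : set (R * R) := [set z | disc z /\ [/\ 1 - rad z <= q, a <= ang z &
       ang z <= dyad R M J.+1 + 2 * pi * q]].
have mD := @measurable_disc R; have mL := mLam hlam; have L0 := Lam_ge0 hlam.
have mA : measurable A.
  rewrite (_ : A = disc `&` [set z | 1 - rad z <= q] `&` [set z | a <= ang z] `&`
     [set z | ang z <= dyad R M J.+1 + 2 * pi * q]); last first.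
    by apply/seteqP; split => z; [move=> [? []]|move=> [[[? ?] ?] ?]].
  have ma := @measurable_ang R; have mr := @measurable_rad R.
  apply: measurableI; [apply: measurableI; [apply: measurableI => //|]|];
    apply: measurable_set_le => //; exact: measurable_funB.
have AD : A `<=` disc by move=> z [].
have w0 m j z : disc z -> 0 <= wgt i m j z by exact: wgt_ge0.
have mw m j : measurable_fun disc (wgt i m j) by exact: measurable_wgt.
have := @tsum_integral _ _ R tau disc Lam mD mL L0 (wgt i) (wmass i) mw w0 (wmassE i) N M J.
move=> tE; rewrite -lee_fin -tE.
have := @integral_le_weighted_sum _ _ R tau disc Lam mD mL L0 disc
  (fun z => tsum (fun m j => wgt i m j z) N M J) 1 (fun=> 2) (fun=> A) mD (@subset_refl _ _).
move=> /(_ _ _ _ _ _ _)/wrap[].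
- exact: measurable_tsum.
- by move=> z zD; apply: tsum_ge0 => m j; exact: w0.
- by [].
- by [].
- by [].
- by move=> z zD; rewrite big_ord1; exact: tsum_wgt_le.
move=> /le_trans; apply; rewrite big_ord1.
(* Consecutive sectors of angular width [2 * q]; truncating [y] below picks the one that contains
   [z]. *)
pose S l : set (R * R) := sector q (a + (2 * l%:R + 1) * q).
have := @integral_le_cover _ _ R tau disc Lam mD mL L0 A 12 S mA AD.
move=> /(_ _ _ _)/wrap[].
- by move=> l; exact: measurable_sector.
- by move=> l; exact: sector_disc.
- move=> z [zD [h1 h2 h3]]; pose y := (ang z - a) / (2 * q).
  have y0 : 0 <= y by rewrite divr_ge0//; lra.
  have /andP[y1 y2] := truncn_itv y0.
  rewrite /a dyadS -/q in h2 h3.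
  have yE : y * (2 * q) = ang z - a by rewrite divfK// gt_eqF//; lra.
  have y12 : (Num.truncn y < 12)%N.
    rewrite truncn_lt_nat// -(ltr_pM2r (_ : 0 < 2 * q)); last lra.
    by rewrite yE /a; lra.
  exists (Num.truncn y) => //; exists (rad z), (ang z); split.
  - lra.
  - by apply/discE.
  - have z1 := ler_wpM2r (_ : 0 <= 2 * q) y1; have z2 := ler_wpM2r (_ : 0 <= 2 * q) (ltW y2).
    move: z1 z2; rewrite yE -natr1 => /(_ ltac:(lra)) z1 /(_ ltac:(lra)) z2.
    by rewrite ler_norml; apply/andP; split; lra.
  - exact: polarE.
move=> cov.
set V := W a (a + 24 * q).
have cov2 : (\int[tau]_(z in A) (Lam z)%:E <= (12 * (D * V))%:E)%E.
  apply: le_trans cov _.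
  apply: (@le_trans _ _ (\sum_(l < 12) (D * V)%:E)%E); last first.
    by rewrite sumEFin lee_fin sumr_const card_ord -[leLHS]mulr_natl.
  apply: lee_sum => l _; apply: le_trans (hDs _ _ q0 q1) _.
  rewrite lee_fin ler_wpM2l//.
  have l0 : 0 <= (l : nat)%:R :> R by [].
  have l11 : (l : nat)%:R <= 11 :> R by rewrite ler_nat -ltnS.
  have lq0 := mulr_ge0 l0 (ltW q0); have lq := ler_wpM2r (ltW q0) l11.
  by apply: ifun_mono => //; lra.
apply: le_trans (lee_wpmul2l _ cov2) _; first by rewrite lee_fin.
rewrite -EFinM lee_fin.
have U0 : 0 < itree W M J by apply: A2_pair_gt0 hK _; rewrite dyadS -/q; lra.
have dbl := A2_doubling (a := dyad R M J) (b := dyad R M J.+1) (a' := a) (b' := a + 24 * q)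
  hK ltac:(rewrite /a; lra) ltac:(rewrite dyadS -/q; lra) ltac:(rewrite /a dyadS -/q; lra)
  ltac:(lra).
rewrite -/V -/(itree W M J) in dbl.
have V0 : 0 <= V by apply: W0; lra.
have dbl' : V <= 36 * K * itree W M J.
  rewrite -(ler_pM2r (_ : 0 < 16 * q ^+ 2)); last by rewrite mulr_gt0// exprn_gt0.
  apply: (@le_trans _ _ (V * (dyad R M J.+1 - dyad R M J) ^+ 2)).
    rewrite ler_wpM2l// dyadS -/q.
    have -> : 16 * q ^+ 2 = (4 * q) ^+ 2 by ring.
    by rewrite ler_sqr ?nnegrE; lra.
  apply: le_trans dbl _.
  have -> : a + 24 * q - a = 24 * q by ring.
  by rewrite le_eqVlt; apply/orP; left; apply/eqP; ring.
have := ler_wpM2l D0 dbl'; lra.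
Qed.

Lemma ge0_strong_embedding : exists2 C : R, 0 <= C & forall g : R -> R,
  measurable_fun setT g -> (forall t, 0 <= g t) -> periodic2pi g ->
  periodic_density (fun t => (g t ^+ 2 * mu t)%:E) ->
  (\int[tau]_(z in disc) (pext g z ^+ 2 * Lam z)%:E <=
   (C * rmass (fun t => (g t ^+ 2 * mu t)%:E) (- pi) pi)%:E)%E.
Proof.
have [K hK] := A2_pairP hmu; have K1 := A2_pair_ge1 hK; have [D0 hDs] := hD.
have pi2 := @pi_ge2 R; have pi4 := @pi_lt4 R.
have [hW hS] := A2_density hmu.
(* The added 1 keeps the constant positive when [D = 0]. *)
pose C0 := 24 * 36 * D * K + 1; pose c1 : R := (32 * 16) ^+ 2 * (6 * 64).
have C00 : 0 < C0 by rewrite ltr_wpDl// !mulr_ge0//; lra.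
have c10 : 0 <= c1 by rewrite mulr_ge0// sqr_ge0.
(* [12 = 3 * 4] counts the neighbour offsets and the roots. *)
exists (c1 * (12 * (16 * C0 * K ^+ 2))).
  apply: mulr_ge0 => //; apply: mulr_ge0 => //; apply: mulr_ge0; last exact: sqr_ge0.
  exact: mulr_ge0 (ltW C00).
move=> g mg g0 gp hY; have hg := density_of_weighted_L2 hmu mg g0 gp hY.
set Y := rmass _; set X := rmass (EFin \o g).
have iX : interval_function X := rmass_interval_function hg.
have iY : interval_function Y := rmass_interval_function hY.
have iW := rmass_interval_function hW; have iS := rmass_interval_function hS.
have [X0 _ _] := iX; have [Y0 _ _] := iY.
pose L (m j : nat) : R := 2 * pi * 2^-1 ^+ m.
have L0 m j : 0 < L m j by rewrite mulr_gt0 ?expV2_gt0//; lra.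
have dlt m j : dyad R m j < dyad R m j.+1 by rewrite dyadS ltrDl; exact: (L0 m j).
have Lle m j : L m j <= 8.
  rewrite /L -[leRHS]mulr1; apply: ler_pM; [lra|exact/ltW/expV2_gt0|lra|exact: expV2_le1].
have Ld m j : dyad R m j.+1 - dyad R m j = L m j by rewrite dyadS addrAC subrr add0r.
have [_ _ AK AL] := hK.
have emb i N J : (i < 3)%N ->
    tsum (fun m j => wmass i m j * (itree X m j / L m j) ^+ 2) N 0 J <=
    16 * C0 * K ^+ 2 * Y (- pi) pi.
  move=> i3.
  (* Every root arc is a full period. *)
  have -> : Y (- pi) pi = itree Y 0 J.
    by rewrite /itree dyadS expr0 mulr1 ifun_period.
  apply: (@two_weight_embedding R C0 K (itree W) (itree (rmass (einv mu))) L (itree X) (itree Y)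
    (wmass i) N 0 J) => //.
  - lra.
  - exact: itree_additive.
  - exact: itree_additive.
  - by move=> m j; rewrite /L exprSr; field.
  - exact: itree_additive.
  - exact: itree_additive.
  - by move=> m j; apply: A2_pair_gt0 hK _.
  - by move=> m j; apply: A2_pair_gt0 (A2_pair_sym hK) _.
  - by move=> m j; rewrite -(Ld m j); exact: AL.
  - move=> m j; rewrite -(Ld m j); apply: AK => //.
    by have := Lle m j; rewrite -(Ld m j); lra.
  - by move=> m j; apply: X0; exact: ltW.
  - by move=> m j; exact: weighted_cauchy_schwarz.
  - by move=> m j; exact: wmass_ge0.
  - move=> N' m j; apply: le_trans (wmass_carleson N' m j hK i3) _.
    have U0 : 0 < itree W m j by apply: A2_pair_gt0 hK _.
    by rewrite ler_wpM2r// ?lerDl// ltW.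
have mD := @measurable_disc R; have mL := mLam hlam; have Lm0 := Lam_ge0 hlam.
pose q m j := (itree X m j / L m j) ^+ 2.
pose w i m j z := wgt i m j z * q m j.
have w0 i m j z : disc z -> 0 <= w i m j z.
  by move=> zD; rewrite mulr_ge0 ?wgt_ge0 ?sqr_ge0.
have mw i m j : measurable_fun disc (w i m j).
  by apply: measurable_funM => //; exact: measurable_wgt.
have wE i m j : (\int[tau]_(z in disc) (w i m j z * Lam z)%:E = (wmass i m j * q m j)%:E)%E.
  rewrite mulrC EFinM -wmassE -ge0_integralZl_EFin//.
  - by apply: eq_integral => z _; rewrite -EFinM /w; congr EFin; ring.
  - by move=> z zD; rewrite lee_fin mulr_ge0 ?wgt_ge0 ?Lm0.
  - by apply/measurable_EFinP; apply: measurable_funM => //; exact: measurable_wgt.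
  - exact: sqr_ge0.
pose G N z : R := \sum_(i < 3) \sum_(J < 4) tsum (fun m j => w i m j z) N 0 J.
have G0 N z : disc z -> 0 <= G N z.
  by move=> zD; apply: sumr_ge0 => i _; apply: sumr_ge0 => J _; apply: tsum_ge0 => m j; exact: w0.
have mG N : measurable_fun disc (G N).
  apply: measurable_sum => i; apply: measurable_sum => J.
  exact: measurable_tsum.
have GI N : (\int[tau]_(z in disc) (c1 * G N z * Lam z)%:E <=
    (c1 * (12 * (16 * C0 * K ^+ 2)) * Y (- pi) pi)%:E)%E.
  under eq_integral do rewrite -mulrA EFinM.
  rewrite ge0_integralZl_EFin//; last 2 first.
  - by move=> z zD; rewrite lee_fin mulr_ge0 ?G0 ?Lm0.
  - by apply/measurable_EFinP; exact: measurable_funM.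
  rewrite -[X in (_ <= X%:E)%E]mulrA [X in (_ <= X)%E]EFinM lee_wpmul2l ?lee_fin//.
  have tm i J : measurable_fun disc
      (fun z => (tsum (fun m j => w i m j z) N 0 J * Lam z)%:E).
    by apply/measurable_EFinP; apply: measurable_funM => //; exact: measurable_tsum.
  have t0 i J z : disc z -> (0 <= (tsum (fun m j => w i m j z) N 0 J * Lam z)%:E)%E.
    by move=> zD; rewrite lee_fin mulr_ge0 ?Lm0// tsum_ge0// => m j; exact: w0.
  rewrite (eq_integral (fun z => \sum_(i < 3) \sum_(J < 4)
      (tsum (fun m j => w i m j z) N 0 J * Lam z)%:E)%E); last first.
    move=> z _; rewrite /G mulr_suml -sumEFin; apply: eq_bigr => i _.
    by rewrite mulr_suml -sumEFin.
  rewrite ge0_integral_sum//; last 2 first.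
  - by move=> i; apply: emeasurable_sum => J; exact: tm.
  - by move=> i z zD; apply: sume_ge0 => J _; exact: t0.
  apply: (@le_trans _ _ (\sum_(i < 3) \sum_(J < 4) (16 * C0 * K ^+ 2 * Y (- pi) pi)%:E)%E).
    apply: lee_sum => i _; rewrite ge0_integral_sum//; last by move=> J z zD; exact: t0.
    apply: lee_sum => J _.
    rewrite (@tsum_integral _ _ R tau disc Lam mD mL Lm0 (w i) (fun m j => wmass i m j * q m j)
      (mw i) (w0 i) (wE i)) lee_fin.
    by apply: emb.
  under eq_bigr do rewrite sumEFin.
  by rewrite sumEFin lee_fin !sumr_const !card_ord -[leLHS]mulr_natl -[_ *+ 4]mulr_natl; lra.
(* These sets exhaust the disc, and on [B N] the pointwise bound needs [N + 2] generations; the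
   estimate is uniform in [N], so monotone convergence applies. *)
pose B N : set (R * R) := [set z | 2^-1 ^+ N <= 2 * (1 - rad z)].
have mB N : measurable (B N).
  apply: measurable_set_le => //; apply: measurable_funM => //.
  by apply: measurable_funB => //; exact: measurable_rad.
have mp : measurable_fun disc (fun z => pext g z ^+ 2 * Lam z).
  by apply: measurable_funM => //; apply: measurable_funX; exact: measurable_pext.
have p0 z : disc z -> 0 <= pext g z ^+ 2 * Lam z.
  by move=> zD; apply: mulr_ge0 (Lm0 _ zD); exact: sqr_ge0.
pose F N z : \bar R := (\1_(B N) z * (pext g z ^+ 2 * Lam z))%:E.
have F0 N z : disc z -> (0 <= F N z)%E.
  by move=> zD; rewrite lee_fin; apply: mulr_ge0 (p0 z zD); rewrite indicE.
have mF N : measurable_fun disc (F N).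
  by apply/measurable_EFinP; apply: measurable_funM => //; exact: measurable_indic.
have BS m n : (m <= n)%N -> B m `<=` B n.
  by move=> mn z; rewrite /B /= => h; apply: le_trans h; exact: expV2_le.
have ndF z : disc z -> nondecreasing_seq (F^~ z).
  move=> zD m n mn; rewrite lee_fin; apply: (ler_wpM2r (p0 z zD)).
  rewrite !indicE; case: (boolP (z \in B m)) => [|_]; last by rewrite ler0n.
  by rewrite inE => /(BS _ _ mn) zB; rewrite (mem_set zB).
have FI N : (\int[tau]_(z in disc) F N z <=
    (c1 * (12 * (16 * C0 * K ^+ 2)) * Y (- pi) pi)%:E)%E.
  apply: le_trans (GI N.+2); apply: ge0_le_integral => //.
  - by move=> z zD; exact: F0.
  - by apply/measurable_EFinP; apply: measurable_funM => //; exact: measurable_funM.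
  move=> z zD; rewrite lee_fin indicE.
  have := G0 N.+2 z zD => Gz.
  case: (boolP (z \in B N)) => [|_]; last first.
    by rewrite mul0r; apply: mulr_ge0 (Lm0 _ zD); exact: mulr_ge0 c10 Gz.
  rewrite inE => zB; rewrite mul1r ler_wpM2r ?Lm0//.
  exact: pext_sqr_le.
have cvgF := cvg_monotone_convergence (mu := tau) mD mF F0 ndF.
have -> : (\int[tau]_(z in disc) (pext g z ^+ 2 * Lam z)%:E =
    \int[tau]_(z in disc) limn (F^~ z))%E.
  apply: eq_integral => z; rewrite inE => zD; apply/esym.
  have r1 : rad z < 1 by apply/discE.
  have [n [n1 n2]] := @dyadic_level R (1 - rad z) ltac:(lra) ltac:(have := rad_ge0 z; lra).
  apply: lim_near_cst => //; exists n => // m /= nm.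
  have zB : z \in B m by rewrite inE; apply: BS nm _ _; exact: n2.
  by rewrite /F indicE zB mul1r.
rewrite -(cvg_lim _ cvgF)//; apply: lime_le; first by apply/cvg_ex; eexists; exact: cvgF.
by apply: nearW => N; exact: FI.
Qed.

(** Both parts of [f] are dominated by [g = |fr| + |fi|], and [g^2 <= 2 * |f|^2]. In the constant,
    the first 2 counts the parts, the second is this 2, and [8 >= 2 * pi] undoes the
    normalisation. *)
Lemma sector_to_strong : exists B, strong_carleson mu lam tau B.
Proof.
have [C C0 H] := ge0_strong_embedding.
have pi2 := @pi_ge2 R; have pi4 := @pi_lt4 R.
exists (2 * C * (2 * 8)) => fr fi mfr mfi pfr pfi fin.
have [mmu mu0 pmu _] := hmu.
pose g t := `|fr t| + `|fi t|.
have mg : measurable_fun setT g.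
  by apply: measurable_funD; exact: measurableT_comp.
have g0 t : 0 <= g t by rewrite addr_ge0.
have gp : periodic2pi g by move=> t; rewrite /g pfr pfi.
pose s t : \bar R := ((fr t ^+ 2 + fi t ^+ 2) * mu t)%:E.
have s0 t : (0 <= s t)%E by rewrite lee_fin mulr_ge0// addr_ge0 ?sqr_ge0.
have ms : measurable_fun setT s.
  apply/measurable_EFinP; apply: measurable_funM => //.
  by apply: measurable_funD; exact: measurable_funX.
have hs : periodic_density s.
  split => //; first by move=> t; rewrite /s pfr pfi pmu.
  move: fin; rewrite /wL2norm2 -/(imass s (- pi) pi).
  have : (0 <= imass s (- pi) pi)%E by exact: imass_ge0.
  case: (imass s (- pi) pi) => [x _ _||]//; first by rewrite ltry.
  by rewrite gt0_muley ?lte_fin ?invr_gt0//; lra.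
have gs t : ((g t ^+ 2 * mu t)%:E <= 2%:E * s t)%E.
  rewrite /s -EFinM lee_fin mulrA ler_wpM2r// /g.
  rewrite -[fr t ^+ 2]real_normK ?num_real// -[fi t ^+ 2]real_normK ?num_real//.
  by have := sqr_ge0 (`|fr t| - `|fi t|); nra.
have gm0 t : (0 <= (g t ^+ 2 * mu t)%:E)%E by rewrite lee_fin mulr_ge0 ?sqr_ge0.
have mgm : measurable_fun setT (fun t => (g t ^+ 2 * mu t)%:E).
  by apply/measurable_EFinP; apply: measurable_funM => //; exact: measurable_funX.
have i2 : (imass (fun t => (g t ^+ 2 * mu t)%:E) (- pi) pi <= 2%:E * imass s (- pi) pi)%E.
  rewrite /imass -ge0_integralZl_EFin//; last exact: measurable_funTS.
  apply: ge0_le_integral => //; first exact: measurable_funTS.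
  by apply: measurable_funeM; exact: measurable_funTS.
have hY : periodic_density (fun t => (g t ^+ 2 * mu t)%:E).
  split => //; first by move=> t; rewrite gp pmu.
  by apply: le_lt_trans i2 _; rewrite rmassK// -EFinM ltry.
have hg := density_of_weighted_L2 hmu mg g0 gp hY.
have Hg := H g mg g0 gp hY.
have Yle : rmass (fun t => (g t ^+ 2 * mu t)%:E) (- pi) pi <= 2 * rmass s (- pi) pi.
  by rewrite -lee_fin EFinM -!rmassK.
have mD := @measurable_disc R; have mL := mLam hlam; have Lm0 := Lam_ge0 hlam.
have mp : measurable_fun disc (fun z => (pext g z ^+ 2 * Lam z)%:E).
  apply/measurable_EFinP; apply: measurable_funM => //; apply: measurable_funX.
  exact: measurable_pext.
have frg t : `|fr t| <= g t by rewrite lerDl.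
have fig t : `|fi t| <= g t by rewrite lerDr.
have step : (\int[tau]_(z in disc) ((pext fr z ^+ 2 + pext fi z ^+ 2) * Lam z)%:E <=
   2%:E * \int[tau]_(z in disc) (pext g z ^+ 2 * Lam z)%:E)%E.
  rewrite -ge0_integralZl_EFin//; last first.
    by move=> z zD; rewrite lee_fin mulr_ge0 ?sqr_ge0 ?Lm0.
  apply: ge0_le_integral => //.
  - by move=> z zD; rewrite lee_fin mulr_ge0 ?addr_ge0 ?sqr_ge0 ?Lm0.
  - apply/measurable_EFinP; apply: measurable_funM => //.
    by apply: measurable_funD; apply: measurable_funX; exact: measurable_pext_dominated hg _ _.
  - exact: measurable_funeM.
  move=> z zD; rewrite -EFinM lee_fin [leRHS]mulrA; apply: (ler_wpM2r (Lm0 _ zD)).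
  have h1 := normr_pext_le hg mfr frg zD; have h2 := normr_pext_le hg mfi fig zD.
  rewrite -[pext fr z ^+ 2]real_normK ?num_real// -[pext fi z ^+ 2]real_normK ?num_real//.
  rewrite mulr_natl mulr2n lerD// ler_sqr ?nnegrE// (le_trans _ h1)//.
apply: le_trans step _.
apply: (@le_trans _ _ (2%:E * (C * (2 * rmass s (- pi) pi))%:E)%E).
  apply: lee_wpmul2l; first by rewrite lee_fin.
  by apply: le_trans Hg _; rewrite lee_fin ler_wpM2l.
rewrite /wL2norm2 -/(imass s (- pi) pi) rmassK// -!EFinM lee_fin.
set r := rmass s _ _.
have r0 : 0 <= r by rewrite fine_ge0// imass_ge0.
have -> : 2 * (C * (2 * r)) = 2 * C * 2 * r by ring.
have -> : 2 * C * (2 * 8) * ((2 * pi)^-1 * r) = 2 * C * 2 * r * (8 / (2 * pi)) by ring.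
rewrite ler_peMr//; first by rewrite !mulr_ge0.
by rewrite ler_pdivlMr; lra.
Qed.

End SectorImpliesStrong.

(** * Equivalence of the three conditions *)

Theorem theorem1p5 (R : realType) (mu lam : R -> R)
    (tau : {measure set (R * R)%type -> \bar R}) :
  A2 mu -> A2 lam ->
  let TFAE_i :=
    exists B : R, forall fr fi : R -> R,
      measurable_fun setT fr -> measurable_fun setT fi ->
      periodic2pi fr -> periodic2pi fi ->
      (wL2norm2 mu fr fi < +oo)%E ->
      (\int[tau]_(z in @disc R)
          (((pext fr z) ^+ 2 + (pext fi z) ^+ 2) * pext lam z)%:E
        <= B%:E * wL2norm2 mu fr fi)%E in
  let TFAE_ii :=
    exists C : R, forall z, @disc R z ->
      (((pext mu z)^-1)%:E *
        \int[tau]_(w in @disc R) (poisson z w * pext lam w)%:E < C%:E)%E in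
  let TFAE_iii :=
    exists D : R, forall h theta0 : R, 0 < h -> h <= 1 ->
      ((fine (arcmass mu h theta0))^-1%:E *
        \int[tau]_(w in sector h theta0) (pext lam w)%:E < D%:E)%E in
  (TFAE_i <-> TFAE_ii) /\ (TFAE_ii <-> TFAE_iii).
Proof.
move=> hmu hlam TFAE_i TFAE_ii TFAE_iii.
have [hW _] := A2_density hmu; have [K hK] := A2_pairP hmu.
have pi2 := @pi_ge2 R; have pi4 := @pi_lt4 R; have p0 : 0 < (2 * pi : R)^-1 by rewrite invr_gt0; lra.
have ii_C : TFAE_ii <-> exists C, kernel_carleson mu lam tau C.
  have I0 z : disc z -> (0 <= \int[tau]_(w in @disc R) (poisson z w * pext lam w)%:E)%E.
    move=> zD; apply: integral_ge0 => w wD; rewrite lee_fin.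
    exact: mulr_ge0 (poisson_ge0 w zD) (Lam_ge0 hlam wD).
  split=> -[C hC].
    exists `|C|; split => // z zD.
    apply: le_trans (inv_mul_lt_le (pext_A2_gt0 hmu zD) (I0 z zD) (hC z zD)) _.
    by rewrite lee_fin ler_wpM2r ?ler_norm// ltW// pext_A2_gt0.
  exists (C + 1) => z zD; apply: le_inv_mul_lt (pext_A2_gt0 hmu zD) (I0 z zD) _.
  exact: hC.2.
have iii_D : TFAE_iii <-> exists D, sector_carleson mu lam tau D.
  have aE h t : fine (arcmass mu h t) =
      (2 * pi)^-1 * rmass (EFin \o mu) (t - h / 2) (t + h / 2).
    by rewrite /arcmass -/(imass (EFin \o mu) (t - h / 2) (t + h / 2)) rmassK.
  have a0 h t : 0 < h -> 0 < fine (arcmass mu h t).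
    by move=> h0; rewrite aE mulr_gt0//; apply: A2_pair_gt0 hK _; lra.
  have I0 h t : 0 < h -> h <= 1 -> (0 <= \int[tau]_(w in sector h t) (pext lam w)%:E)%E.
    move=> h0 h1; apply: integral_ge0 => w wS; rewrite lee_fin (Lam_ge0 hlam)//.
    exact: sector_disc wS.
  split=> -[D hD].
    exists `|D|; split => // h t h0 h1.
    apply: le_trans (inv_mul_lt_le (a0 h t h0) (I0 h t h0 h1) (hD h t h0 h1)) _.
    rewrite lee_fin aE; apply: (@le_trans _ _ (`|D| * ((2 * pi)^-1 *
      rmass (EFin \o mu) (t - h / 2) (t + h / 2)))).
      by rewrite ler_wpM2r ?ler_norm// -aE ltW// a0.
    rewrite ler_wpM2l// ler_piMl//; last by rewrite invf_le1; lra.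
    by apply/ltW; apply: A2_pair_gt0 hK _; lra.
  (* The factor [2 * pi] undoes the normalisation of the arc mass; the 1 makes the inequality
     strict. *)
  exists (D * (2 * pi) + 1) => h t h0 h1.
  apply: le_inv_mul_lt (a0 h t h0) (I0 h t h0 h1) _.
  rewrite aE -mulrA mulVKf; last by rewrite gt_eqF//; lra.
  exact: hD.2.
have ii_iii : TFAE_ii <-> TFAE_iii.
  split.
    by move=> /ii_C[C /(kernel_to_sector hmu hlam) ?]; apply/iii_D.
  by move=> /iii_D[D /(sector_to_kernel hmu hlam) ?]; apply/ii_C.
split => //; split.
  by move=> [B /(strong_to_sector hmu hlam) ?]; apply/ii_iii/iii_D.
by move=> /ii_iii/iii_D[D /(sector_to_strong hmu hlam)].
Qed.
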